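(* Let $0<q<1$ and $\mathcal X=\mathbb Z_{\ge0}$. Let $\pi_{aqH}$ be the alternative $q$-Hahn measure and $\pi_{lqJ}$, $\check P_{lqJ,n}$ the little $q$-Jacobi measure and polynomials. In each of the following cases $K(x,y)\ge0$, $\sum_{x\in\mathcal X}K(x,y)=1$, and for all $x,y,n\in\mathcal X$ $$K(x,y)\,\pi_{lqJ}(y,\lambda)=K(y,x)\,\pi_{lqJ}(x,\lambda),\qquad \sum_{y\in\mathcal X}K(x,y)\,\pi_{lqJ}(y,\lambda)\,\check P_{lqJ,n}(y,\lambda)=\kappa(n)\,\pi_{lqJ}(x,\lambda)\,\check P_{lqJ,n}(x,\lambda).$$ (i) $0<a<1$, $b<1$, $0<c<1$, $\lambda=(c,ab)$, $$K(x,y)=\sum_{z=0}^{\min(x,y)}\pi_{lqJ}(x-z,c,a)\,\pi_{aqH}(z,y,a,b),\qquad \kappa(n)=\frac{a^n(b;q)_n(c;q)_n}{(ab;q)_n(ac;q)_n}.$$ (iii) $0<a<1$, $0<b<1$, $c<1$, $\lambda=(ab,c)$, $$K(x,y)=\sum_{z=\max(x,y)}^{\infty}\pi_{aqH}(x,z,b,c)\,\pi_{lqJ}(z-y,a,b),\qquad \kappa(n)=\frac{b^n(a;q)_n(c;q)_n}{(ab;q)_n(bc;q)_n}.$$ (iv) $0<a_1,b_1,a_2<1$, $b_2<1$, $\lambda=(a_1b_1,a_2b_2)$, $$K(x,y)=\sum_{z_2=0}^{\min(x,y)}\pi_{aqH}(z_2,y,a_2,b_2)\sum_{z_1=\max(x,y)}^{\infty}\pi_{aqH}(x-z_2,z_1-z_2,b_1,a_2)\,\pi_{lqJ}(z_1-y,a_1,b_1),$$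 $$\kappa(n)=\sum_{k=0}^{n}\frac{(q^{-n};q)_k(a_1b_1a_2b_2q^{n-1};q)_k(b_1;q)_k(a_2;q)_k}{(a_1b_1;q)_k(b_1a_2;q)_k(a_2b_2;q)_k(q;q)_k}q^k.$$
   Context: $(a;q)_n=\prod_{i=0}^{n-1}(1-aq^i)$, $(a;q)_\infty=\prod_{i\ge0}(1-aq^i)$. For $0<a<1$, $b<1$: the alternative $q$-Hahn measure is, for integers $0\le x\le M$, $\pi_{aqH}(x,M,a,b)=\frac{(q;q)_M}{(q;q)_x(q;q)_{M-x}}\frac{(a;q)_{M-x}(b;q)_xa^x}{(ab;q)_M}$; the little $q$-Jacobi measure is, for $x\in\mathbb Z_{\ge0}$, $\pi_{lqJ}(x,a,b)=\frac{(b;q)_xa^x}{(q;q)_x}\frac{(a;q)_\infty}{(ab;q)_\infty}$; the little $q$-Jacobi polynomials (normalised to $1$ at $x=0$) are $\check P_{lqJ,n}(x,a,b)=(-a)^{-n}q^{-\binom n2}\frac{(a;q)_n}{(b;q)_n}\sum_{k=0}^n\frac{(q^{-n};q)_k(abq^{n-1};q)_k}{(a;q)_k(q;q)_k}q^{(x+1)k}$. *)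

(* Defs.v *)
(* MathComp-Analysis: everything is stated over an arbitrary [R : realType]. *)
From HB Require Import structures.
From mathcomp Require Import all_boot all_order all_algebra.
From mathcomp Require Import all_classical all_reals all_analysis.

Set Implicit Arguments.
Unset Strict Implicit.
Unset Printing Implicit Defensive.

Import Order.TTheory GRing.Theory Num.Theory.
Import numFieldNormedType.Exports.

Local Open Scope classical_set_scope.
Local Open Scope ring_scope.

Section Defs.
Context {R : realType}.
Implicit Types (q a b c : R) (x y z M n : nat).

(* (a; q)_n *)
Definition qpoch a q n : R := \prod_(i < n) (1 - a * q ^+ i).

(* (a; q)_oo *)
Definition qpoch_oo a q : R := limn (fun n => qpoch a q n).

(* Alternative q-Hahn measure.  Only meaningful for x <= M: [M - x] is
   truncated, so the value for x > M is junk. *)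
Definition pi_aqH q x M a b : R :=
  qpoch q q M / (qpoch q q x * qpoch q q (M - x))
  * (qpoch a q (M - x) * qpoch b q x * a ^+ x / qpoch (a * b) q M).

(* Little q-Jacobi measure. *)
Definition pi_lqJ q x a b : R :=
  qpoch b q x * a ^+ x / qpoch q q x * (qpoch_oo a q / qpoch_oo (a * b) q).

(* Little q-Jacobi polynomials, normalised to 1 at x = 0.  The exponent n - 1
   is an integer one, hence -1 for n = 0. *)
Definition P_lqJ q n x a b : R :=
  (- a) ^- n * q ^- 'C(n, 2) * (qpoch a q n / qpoch b q n)
  * \sum_(k < n.+1)
      qpoch (q ^- n) q k * qpoch (a * b * q ^ (n%:Z - 1)) q k
      / (qpoch a q k * qpoch q q k) * q ^+ (x.+1 * k)%N.

(* [K x y] is a probability distribution in x for every y, reversible with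
   respect to pi_lqJ(., a, b), and has the little q-Jacobi polynomials times
   pi_lqJ as eigenvectors, with eigenvalues [kappa]. *)
Definition lqJ_solvable q a b (K : nat -> nat -> R) (kappa : nat -> R) : Prop :=
  [/\ forall x y, 0 <= K x y,
      forall y, series (fun x => K x y) @ \oo --> (1 : R),
      forall x y, K x y * pi_lqJ q y a b = K y x * pi_lqJ q x a b
    & forall x n,
        series (fun y => K x y * pi_lqJ q y a b * P_lqJ q n y a b) @ \oo
          --> kappa n * pi_lqJ q x a b * P_lqJ q n x a b].

(* The infinite sums below are limits of partial sums; [limn] is total, so
   their convergence has to be stated separately. *)

Definition K_i q a b c x y : R :=
  \sum_(0 <= z < (minn x y).+1) pi_lqJ q (x - z) c a * pi_aqH q z y a b.

Definition kappa_i q a b c n : R :=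
  a ^+ n * (qpoch b q n * qpoch c q n)
  / (qpoch (a * b) q n * qpoch (a * c) q n).

Definition K_iii_term q a b c x y z : R :=
  pi_aqH q x z b c * pi_lqJ q (z - y) a b.

Definition K_iii q a b c x y : R :=
  \big[+%R/0]_(maxn x y <= z <oo) K_iii_term q a b c x y z.

Definition kappa_iii q a b c n : R :=
  b ^+ n * (qpoch a q n * qpoch c q n)
  / (qpoch (a * b) q n * qpoch (b * c) q n).

Definition K_iv_term q (a1 b1 a2 : R) x y (z2 z1 : nat) : R :=
  pi_aqH q (x - z2) (z1 - z2) b1 a2 * pi_lqJ q (z1 - y) a1 b1.

Definition K_iv q (a1 b1 a2 b2 : R) x y : R :=
  \sum_(0 <= z2 < (minn x y).+1)
    pi_aqH q z2 y a2 b2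
    * \big[+%R/0]_(maxn x y <= z1 <oo) K_iv_term q a1 b1 a2 x y z2 z1.

Definition kappa_iv q (a1 b1 a2 b2 : R) n : R :=
  \sum_(k < n.+1)
    qpoch (q ^- n) q k * qpoch (a1 * b1 * a2 * b2 * q ^ (n%:Z - 1)) q k
    * qpoch b1 q k * qpoch a2 q k
    / (qpoch (a1 * b1) q k * qpoch (b1 * a2) q k * qpoch (a2 * b2) q k
       * qpoch q q k)
    * q ^+ k.

End Defs.

(* Main.v *)
(* Write S g(y) for the mean of g under pi_aqH(., y, a, b) and T f(z) for the mean
   of f(z + w) with w ~ pi_lqJ(c, a).  If y ~ pi_lqJ(c, a b) and z ~ pi_aqH(., y, a, b),
   then z and y - z are independent little q-Jacobi variables, which gives the
   reversibility of K in all cases.  S is diagonal on the falling factorials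
   (q;q)_x / (q;q)_{x-k} (q-Chu-Vandermonde) and T is diagonal on the powers
   q^{kx} (q-binomial theorem).  The polynomials have a terminating expansion in
   each of the two bases, so S maps P_n(., c a, b) to P_n(., c, a b) and T maps
   P_n(., c, a b) back to kappa(n) P_n(., c a, b).  Case (i) is S T and case (iii)
   is T S.

   For (iv), K(x, y) is the mean over z of the kernel (iii) at (x - z, y - z).
   It does not raise the degree in q^x and it is self-adjoint, hence it maps P_n
   to a multiple of P_n by orthogonality; the eigenvalue is the value at y = 0. *)
Require Import Defs.
From HB Require Import structures.
From mathcomp Require Import all_boot all_order all_algebra.
From mathcomp Require Import all_classical all_reals all_analysis.
From mathcomp Require Import ring lra zify.
Import Order.TTheory GRing.Theory Num.Theory.
Import numFieldNormedType.Exports.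
Local Open Scope classical_set_scope.
Local Open Scope ring_scope.

(** * Finite q-shifted factorials, Gaussian binomials and terminating q-Vandermonde sums *)

Section QPochhammer.
Context {R : realType} (q : R).
Implicit Types (a b t : R) (k m n x : nat).

Local Notation qp a n := (qpoch a q n).

Lemma qpoch0 a : qp a 0 = 1.
Proof. by rewrite /qpoch big_ord0. Qed.

Lemma qpochSr a n : qp a n.+1 = qp a n * (1 - a * q ^+ n).
Proof. by rewrite /qpoch big_ord_recr. Qed.

Lemma qpochD a m n : qp a (m + n) = qp a m * qp (a * q ^+ m) n.
Proof.
elim: n => [|n IHn]; first by rewrite addn0 qpoch0 mulr1.
by rewrite addnS !qpochSr IHn -!mulrA exprD.
Qed.

Lemma qpochSl a n : qp a n.+1 = (1 - a) * qp (a * q) n.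
Proof. by rewrite -add1n qpochD qpochSr qpoch0 mul1r expr0 mulr1 expr1. Qed.

Context (q01 : 0 < q < 1).

Lemma qbase_gt0 : 0 < q.
Proof. by case/andP: q01. Qed.

Lemma qbase_neq0 : q != 0.
Proof. by rewrite gt_eqF // qbase_gt0. Qed.

Lemma qexp_gt0 n : 0 < q ^+ n.
Proof. by rewrite exprn_gt0 // qbase_gt0. Qed.

Lemma qexp_neq0 n : q ^+ n != 0.
Proof. by rewrite gt_eqF // qexp_gt0. Qed.

Lemma qexp_le1 n : q ^+ n <= 1.
Proof. by rewrite exprn_ile1 // ltW //; case/andP: q01. Qed.

Lemma mulr_qexp_lt1 a n : a < 1 -> a * q ^+ n < 1.
Proof.
move=> a1; have := qexp_gt0 n; have := qexp_le1 n.
have [a0|a0] := leP 0 a => q1 q0.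
  by apply: le_lt_trans a1; rewrite ler_piMr.
by rewrite (lt_trans _ ltr01)// nmulr_rlt0.
Qed.

Lemma qpoch_gt0 a n : a < 1 -> 0 < qp a n.
Proof. by move=> a1; apply: prodr_gt0 => i _; rewrite subr_gt0 mulr_qexp_lt1. Qed.

Lemma qpoch_neq0 a n : a < 1 -> qp a n != 0.
Proof. by move=> a1; rewrite gt_eqF // qpoch_gt0. Qed.

Lemma qfact_gt0 n : 0 < qp q n.
Proof. by apply: qpoch_gt0; case/andP: q01. Qed.

Lemma qfact_neq0 n : qp q n != 0.
Proof. by rewrite gt_eqF // qfact_gt0. Qed.

Lemma subr1_qexpS_neq0 n : 1 - q ^+ n.+1 != 0.
Proof.
by have := qfact_neq0 n.+1; rewrite qpochSr -exprS mulf_eq0 negb_or => /andP[].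
Qed.

(* Gaussian binomial coefficient; with the value 0 for n < k both Pascal rules
   also hold at the boundary k = n. *)
Definition qbin n k : R :=
  if (k <= n)%N then qp q n / (qp q k * qp q (n - k)) else 0.

Lemma qbinE n k : (k <= n)%N -> qbin n k = qp q n / (qp q k * qp q (n - k)).
Proof. by rewrite /qbin => ->. Qed.

Lemma qbin_small n k : (n < k)%N -> qbin n k = 0.
Proof. by move=> nk; rewrite /qbin leqNgt nk. Qed.

Lemma qbin0 n : qbin n 0 = 1.
Proof. by rewrite qbinE // qpoch0 mul1r subn0 divff // qfact_neq0. Qed.

Lemma qbinn n : qbin n n = 1.
Proof. by rewrite qbinE // subnn qpoch0 mulr1 divff // qfact_neq0. Qed.

Lemma qbinS_top n k : (k <= n)%N ->
  qbin n.+1 k.+1 = qbin n k.+1 + q ^+ (n - k) * qbin n k.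
Proof.
rewrite leq_eqVlt => /predU1P[->|kn].
  by rewrite !qbinn qbin_small // subnn expr0 mulr1 add0r.
have [d ->] : exists d, n = (k + d.+1)%N by exists (n - k.+1)%N; lia.
rewrite !qbinE; try lia.
have -> : ((k + d.+1).+1 - k.+1 = d.+1)%N by lia.
have -> : ((k + d.+1) - k.+1 = d)%N by lia.
have -> : ((k + d.+1) - k = d.+1)%N by lia.
have h : qp q (k + d.+1).+1 = qp q (k + d.+1) * (1 - q ^+ k.+1 * q ^+ d.+1).
  by rewrite qpochSr -exprS -exprD; congr (_ * (1 - q ^+ _)); lia.
rewrite h (qpochSr q k) (qpochSr q d) -!exprS.
have hk := qfact_neq0 k; have hd := qfact_neq0 d.
have hk1 := subr1_qexpS_neq0 k.
have hd1 := subr1_qexpS_neq0 d.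
by field; rewrite hk hd hk1 hd1.
Qed.

Lemma qbinS_bot n k : (k <= n)%N ->
  qbin n.+1 k.+1 = q ^+ k.+1 * qbin n k.+1 + qbin n k.
Proof.
rewrite leq_eqVlt => /predU1P[->|kn].
  by rewrite !qbinn qbin_small // mulr0 add0r.
have [d ->] : exists d, n = (k + d.+1)%N by exists (n - k.+1)%N; lia.
rewrite !qbinE; try lia.
have -> : ((k + d.+1).+1 - k.+1 = d.+1)%N by lia.
have -> : ((k + d.+1) - k.+1 = d)%N by lia.
have -> : ((k + d.+1) - k = d.+1)%N by lia.
have h : qp q (k + d.+1).+1 = qp q (k + d.+1) * (1 - q ^+ k.+1 * q ^+ d.+1).
  by rewrite qpochSr -exprS -exprD; congr (_ * (1 - q ^+ _)); lia.
rewrite h (qpochSr q k) (qpochSr q d) -!exprS.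
have hk := qfact_neq0 k; have hd := qfact_neq0 d.
have hk1 := subr1_qexpS_neq0 k.
have hd1 := subr1_qexpS_neq0 d.
by field; rewrite hk hd hk1 hd1.
Qed.

(** Pascal's rule absorbed into the summand: level [n.+1] is rewritten over level [n], so that the
    inductions for the summation formulas close term by term. [sum_qbinS_bot] serves the same
    purpose for the other Pascal rule. *)
Lemma sum_qbinS_top n (F : nat -> R) :
  \sum_(k < n.+2) qbin n.+1 k * F k
  = \sum_(k < n.+1) qbin n k * (F k + q ^+ (n - k) * F k.+1).
Proof.
rewrite big_ord_recl qbin0 -(qbin0 n).
under eq_bigr => i _ do rewrite lift0 qbinS_top ?leq_ord // mulrDl.
rewrite big_split /= addrA.
have -> : qbin n 0 * F 0%N + \sum_(i < n.+1) qbin n i.+1 * F i.+1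
    = \sum_(i < n.+2) qbin n i * F i.
  by rewrite [RHS]big_ord_recl; congr (_ + _); apply: eq_bigr => i _; rewrite lift0.
rewrite big_ord_recr /= qbin_small // mul0r addr0 -big_split /=.
by apply: eq_bigr => i _; rewrite mulrDr; congr (_ + _); ring.
Qed.

Lemma sum_qbinS_bot n (F : nat -> R) :
  \sum_(k < n.+2) qbin n.+1 k * F k
  = \sum_(k < n.+1) qbin n k * (q ^+ k * F k + F k.+1).
Proof.
rewrite big_ord_recl qbin0 -(qbin0 n).
under eq_bigr => i _ do rewrite lift0 qbinS_bot ?leq_ord // mulrDl.
rewrite big_split /= addrA.
have -> : qbin n 0 * F 0%N + \sum_(i < n.+1) q ^+ i.+1 * qbin n i.+1 * F i.+1
    = \sum_(i < n.+2) q ^+ i * qbin n i * F i.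
  by rewrite [RHS]big_ord_recl /= expr0 mul1r.
rewrite big_ord_recr /= qbin_small // mulr0 mul0r addr0 -big_split /=.
by apply: eq_bigr => i _; rewrite mulrDr; congr (_ + _); ring.
Qed.

(** After Pascal's rule the two contributions in [a * q ^+ (n - k)] cancel, and every summand is
    multiplied by the same factor [1 - a * b * q ^+ n]. *)
Lemma qVandermonde n a b :
  \sum_(k < n.+1) qbin n k * (qp a (n - k) * qp b k * a ^+ k) = qp (a * b) n.
Proof.
elim: n => [|n IHn]; first by rewrite big_ord1 qbinn !qpoch0 expr0 !mulr1.
rewrite (sum_qbinS_top n (fun k => qp a (n.+1 - k) * qp b k * a ^+ k)) qpochSr.
rewrite -IHn mulr_suml; apply: eq_bigr => -[k /= kn] _.
have [d ->] : exists d, n = (k + d)%N by exists (n - k)%N; lia.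
rewrite subSS addKn subSn ?leq_addr // addKn !qpochSr exprS exprD.
ring.
Qed.

(** The sum of 2phi1(q^{-n}, b; c; q, q), multiplied by (c;q)_n. The product on the right stands for
    b^n (c/b;q)_n and makes sense for [b = 0] too. The induction passes from [c] to [c * q]. *)
Lemma qVandermonde_rev n b c :
  \sum_(k < n.+1) qbin n k * ((-1) ^+ k * q ^+ ('C(k, 2) + k) * (q ^- n) ^+ k
      * (qp b k * qp (c * q ^+ k) (n - k)))
  = \prod_(i < n) (b - c * q ^+ i).
Proof.
elim: n c => [|n IHn] c.
  by rewrite big_ord1 big_ord0 /= qbinn !qpoch0 !expr0 !mulr1.
rewrite (sum_qbinS_top n (fun k => (-1) ^+ k * q ^+ ('C(k, 2) + k)
  * (q ^- n.+1) ^+ k * (qp b k * qp (c * q ^+ k) (n.+1 - k)))).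
rewrite big_ord_recl expr0 mulr1.
under [X in _ = _ * X]eq_bigr => i _ do rewrite lift0 exprS mulrA.
rewrite -IHn mulr_sumr; apply: eq_bigr => -[k /= kn] _.
have [d ->] : exists d, n = (k + d)%N by exists (n - k)%N; lia.
rewrite subSS addKn subSn ?leq_addr // addKn (qpochSl _ d) qpochSr.
have -> : ('C(k.+1, 2) + k.+1 = 'C(k, 2) + k + k.+1)%N by rewrite binS bin1.
have -> : q ^- (k + d).+1 = q ^- (k + d) / q by rewrite exprSr invfM.
rewrite [_ ^+ k.+1]exprS [(_ / q) ^+ k.+1]exprS !exprMn (exprVn q k).
move: ((q ^- (k + d)) ^+ k) => Y.
have -> : c * q * q ^+ k = c * q ^+ k * q by ring.
have -> : c * q ^+ k.+1 = c * q ^+ k * q by rewrite exprSr mulrA.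
have q0 := qbase_neq0; have h1 := qexp_neq0 k; have h2 := qexp_neq0 d.
rewrite !exprD exprS.
by field; rewrite ?q0 ?h1 ?h2.
Qed.

(** The sum of 2phi1(q^{-n}, b; c; q, c q^n / b), multiplied by (c;q)_n and parametrised by c = b t
    to avoid dividing by [b]. The induction passes from [t] to [t * q]. *)
Lemma qVandermonde_tail n b t :
  \sum_(k < n.+1) qbin n k * ((-1) ^+ k * q ^+ 'C(k, 2)
      * (qp b k * qp (b * t * q ^+ k) (n - k)) * t ^+ k)
  = qp t n.
Proof.
elim: n t => [|n IHn] t.
  by rewrite big_ord1 /= qbinn !qpoch0 !expr0 !mulr1.
rewrite (sum_qbinS_bot n (fun k => (-1) ^+ k * q ^+ 'C(k, 2)
  * (qp b k * qp (b * t * q ^+ k) (n.+1 - k)) * t ^+ k)).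
rewrite qpochSl -IHn mulr_sumr; apply: eq_bigr => -[k /= kn] _.
have [d ->] : exists d, n = (k + d)%N by exists (n - k)%N; lia.
rewrite subSS addKn subSn ?leq_addr // addKn (qpochSl _ d) qpochSr.
rewrite binS bin1 exprD !exprS exprMn.
have -> : b * t * (q * q ^+ k) = b * t * q ^+ k * q by ring.
have -> : b * (t * q) * q ^+ k = b * t * q ^+ k * q by ring.
ring.
Qed.

Lemma qpoch_negexp n k : (k <= n)%N ->
  qp (q ^- n) k
  = (-1) ^+ k * q ^+ 'C(k, 2) * (q ^- n) ^+ k * (qp q n / qp q (n - k)).
Proof.
elim: k => [_|k IHk kn].
  by rewrite qpoch0 !expr0 subn0 divff ?qfact_neq0 // !mulr1.
rewrite qpochSr IHk; last exact: ltnW.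
have [d ->] : exists d, n = (k + d.+1)%N by exists (n - k.+1)%N; lia.
have -> : ((k + d.+1) - k.+1 = d)%N by lia.
rewrite addKn (qpochSr q d) binS bin1 -exprS !exprD.
have hd := qfact_neq0 d.
have hd1 := subr1_qexpS_neq0 d.
have h1 := qexp_neq0 k; have h2 := qexp_neq0 d.+1.
rewrite [(-1) ^+ k.+1]exprS [(_ ^-1) ^+ k.+1]exprS.
by field; rewrite ?hd ?hd1 ?h1 ?h2.
Qed.

Lemma qpoch_negexp_div n k : (k <= n)%N ->
  qp (q ^- n) k / qp q k
  = qbin n k * ((-1) ^+ k * q ^+ 'C(k, 2) * (q ^- n) ^+ k).
Proof.
move=> kn; rewrite qpoch_negexp // qbinE // invfM.
set a := qp q n; set b := (qp q k)^-1; set c := (qp q (n - k))^-1.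
ring.
Qed.

End QPochhammer.

(** * Falling factorials in q^x and the expansion of the little q-Jacobi polynomials in them *)

Section FallingBasis.
Context {R : realType} (q : R) (q01 : 0 < q < 1).
Implicit Types (a b t u A B : R) (j k m n x : nat).

Local Notation qp a n := (qpoch a q n).
Local Notation ef k x := (qpoch (q ^+ x) q^-1 k).

Let q0 := qbase_neq0 q q01.
Let qX0 := qexp_neq0 q q01.

(* [qpoch u q^-1 j] is the product of the 1 - u q^{-i} for i < j; at u = q^x it
   is the falling factorial (q;q)_x / (q;q)_{x-j}, see [qfallE]. *)
Lemma exp_qfall u k :
  u ^+ k = \sum_(j < k.+1)
    qbin q k j * ((-1) ^+ j * q ^+ 'C(j, 2) * qpoch u q^-1 j).
Proof.
elim: k => [|k IHk].
  by rewrite big_ord1 /= qbinn // qpoch0 !expr0 !mulr1.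
rewrite (sum_qbinS_bot _ q01 k
  (fun j => (-1) ^+ j * q ^+ 'C(j, 2) * qpoch u q^-1 j)).
rewrite exprS IHk mulr_sumr; apply: eq_bigr => j _.
rewrite qpochSr binS bin1 exprS exprD exprVn.
have h := qX0 j; by field.
Qed.

Lemma qfall_small j x : (x < j)%N -> ef j x = 0.
Proof.
move=> xj; apply/eqP/prodf_eq0; exists (Ordinal xj) => //=.
by rewrite exprVn divff ?subrr.
Qed.

Lemma qfallE j x : (j <= x)%N -> ef j x = qp q x / qp q (x - j).
Proof.
elim: j => [_|j IHj jx]; first by rewrite qpoch0 subn0 divff // qfact_neq0.
rewrite qpochSr IHj; last exact: ltnW.
have [d ->] : exists d, x = (j + d.+1)%N by exists (x - j.+1)%N; lia.
have -> : ((j + d.+1) - j.+1 = d)%N by lia.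
rewrite addKn (qpochSr q q d) -exprS exprD exprVn.
have hd := qfact_neq0 q q01 d.
have hd1 := subr1_qexpS_neq0 q q01 d.
have h := qX0 j.
by field; rewrite hd hd1 h.
Qed.

Lemma exprz_natB1 n : q ^ (n%:Z - 1) = q ^+ n / q.
Proof. by rewrite expfzDr // expr1z_inv. Qed.

(** Factor [i] equals -A q^i (1 - t q^{n-1-i}), so (t;q)_n appears in reversed order. This evaluates
    the right-hand side of [qVandermonde_rev] in the change of basis below. *)
Lemma prod_subr_qexp A t n :
  \prod_(i < n) (A * t * q ^+ n / q - A * q ^+ i)
  = (- A) ^+ n * q ^+ 'C(n, 2) * qp t n.
Proof.
elim: n => [|n IHn]; first by rewrite big_ord0 qpoch0 !mulr1.
rewrite big_ord_recl.
under eq_bigr => i _.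
  have -> : A * t * q ^+ n.+1 / q - A * q ^+ lift ord0 i
          = q * (A * t * q ^+ n / q - A * q ^+ i).
    by rewrite lift0 !exprS; field.
  over.
rewrite big_split /= prodr_const card_ord IHn qpochSr binS bin1 exprD !exprS.
by field.
Qed.

Lemma sum_triangle n (F : nat -> nat -> R) :
  \sum_(k < n.+1) \sum_(j < k.+1) F k j
  = \sum_(j < n.+1) \sum_(m < (n - j).+1) F (j + m)%N j.
Proof.
elim: n => [|n IHn]; first by rewrite !big_ord1 /= addn0.
rewrite big_ord_recr /= IHn [RHS]big_ord_recr /= subnn big_ord1 addn0.
rewrite [\sum_(j < n.+2) _]big_ord_recr /= addrA; congr (_ + _).
rewrite -big_split /=; apply: eq_bigr => -[j /= jn] _.
by rewrite subSn // [RHS]big_ord_recr /= addnS subnKC.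
Qed.

(* The transformation of the defining 2phi1 into
   3phi1(q^{-n}, A B q^{n-1}, q^{-x}; B; q, q^{x+1}/A). *)
Lemma P_lqJ_qfall n x A B : 0 < A < 1 -> B < 1 ->
  P_lqJ q n x A B
  = \sum_(k < n.+1)
      qp (q ^- n) k * qp (A * B * q ^ (n%:Z - 1)) k / (qp B k * qp q k)
      * (q / A) ^+ k * ef k x.
Proof.
move=> /andP[A0 A1] B1; rewrite /P_lqJ exprz_natB1.
set b := A * B * (q ^+ n / q).
have An0 : A != 0 by rewrite gt_eqF.
have Aq k m : qp (A * q ^+ k) m != 0 by rewrite qpoch_neq0 // mulr_qexp_lt1.
have Ap k : qp A k != 0 by rewrite qpoch_neq0.
have Bp k : qp B k != 0 by rewrite qpoch_neq0.
have Qp k : qp q k != 0 by rewrite qfact_neq0.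
(* Each power of q^x is expanded in falling factorials and the two sums are exchanged; with k = j +
   m, the coefficient of [ef j x] becomes a terminating sum over m. *)
under eq_bigr => k _ do rewrite mulSn exprD (exprM q x k) (exp_qfall (q ^+ x) k)
  !mulr_sumr.
rewrite (sum_triangle n (fun k j => qp (q ^- n) k * qp b k / (qp A k * qp q k) *
  (q ^+ k * (qbin q k j * ((-1) ^+ j * q ^+ 'C(j, 2) * ef j x))))).
rewrite mulr_sumr; apply: eq_bigr => -[j /= jn] _.
set N := (n - j)%N.
have nE : n = (j + N)%N by rewrite /N; lia.
have qn : q ^- n * q ^+ j = q ^- N.
  by rewrite nE exprD; have h1 := qX0 j; have h2 := qX0 N; field; rewrite h1 h2.
(* Separates the factors that depend on [j] alone from a summand of [qVandermonde_rev] at level [N],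
   with parameters [b * q ^+ j] and [A * q ^+ j]. *)
have step m : (m < N.+1)%N ->
  qp (q ^- n) (j + m) * qp b (j + m) / (qp A (j + m) * qp q (j + m)) *
    (q ^+ (j + m) * (qbin q (j + m) j * ((-1) ^+ j * q ^+ 'C(j, 2) * ef j x)))
  = qp (q ^- n) j * qp b j / (qp A j * qp q j) * q ^+ j
      * ((-1) ^+ j * q ^+ 'C(j, 2) * ef j x) / qp (A * q ^+ j) N *
    (qbin q N m * ((-1) ^+ m * q ^+ ('C(m, 2) + m) * (q ^- N) ^+ m *
      (qp (b * q ^+ j) m * qp (A * q ^+ j * q ^+ m) (N - m)))).
  move=> mN.
  have E1 := qpoch_negexp_div q q01 N m mN.
  rewrite !(qpochD q _ j m) qn qbinE ?leq_addr // addKn.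
  have -> : qp (A * q ^+ j) N
          = qp (A * q ^+ j) m * qp (A * q ^+ j * q ^+ m) (N - m).
    by rewrite -qpochD; congr qpoch; lia.
  have -> : qbin q N m * ((-1) ^+ m * q ^+ ('C(m, 2) + m) * (q ^- N) ^+ m *
      (qp (b * q ^+ j) m * qp (A * q ^+ j * q ^+ m) (N - m)))
   = (qp (q ^- N) m / qp q m) * (q ^+ m * 
      (qp (b * q ^+ j) m * qp (A * q ^+ j * q ^+ m) (N - m))).
    by rewrite E1 exprD; ring.
  rewrite exprD -(qpochD q q j m).
  have h1 := Aq j m; have h2 : qp (A * q ^+ j * q ^+ m) (N - m) != 0.
    by rewrite -mulrA -exprD.
  have h3 := Ap j; have h4 := Qp j; have h5 := Qp m; have h6 := Qp (j + m)%N.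
  by field; rewrite h1 h2 h3 h4 h5 h6.
under eq_bigr => i _ do rewrite (step i (ltn_ord i)).
rewrite -mulr_sumr (qVandermonde_rev _ q01 N (b * q ^+ j) (A * q ^+ j)).
have -> : \prod_(i < N) (b * q ^+ j - A * q ^+ j * q ^+ i)
        = (- (A * q ^+ j)) ^+ N * q ^+ 'C(N, 2) * qp (B * q ^+ j) N.
  rewrite -prod_subr_qexp; apply: eq_bigr => i _; congr (_ - _).
  by rewrite /b {1}nE exprD; ring.
have -> : qp A n = qp A j * qp (A * q ^+ j) N by rewrite -qpochD -nE.
have -> : qp B n = qp B j * qp (B * q ^+ j) N by rewrite -qpochD -nE.
have hB : qp (B * q ^+ j) N != 0 by rewrite qpoch_neq0 // mulr_qexp_lt1.
have -> : q ^+ 'C(n, 2) = q ^+ 'C(j, 2) * q ^+ 'C(N, 2) * (q ^+ j) ^+ N.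
  rewrite -exprM -!exprD; congr (_ ^+ _); rewrite nE.
  elim: (N) => [|p IH]; first by rewrite addn0 bin0n muln0 !addn0.
  by rewrite addnS !binS !bin1 IH mulnS; lia.
have -> : (- A) ^+ n = (-1) ^+ j * A ^+ j * (- A) ^+ N.
  by rewrite -exprMn mulN1r -exprD -nE.
have h1 := Aq j N; have h2 := Ap j; have h3 := Bp j; have h4 := Qp j.
have h5 := qX0 'C(j, 2); have h6 := qX0 'C(N, 2).
have -> : - (A * q ^+ j) = - A * q ^+ j by ring.
rewrite !exprMn exprVn.
have h7 : (q ^+ j) ^+ N != 0 by rewrite -exprM.
have h8 : (- A) ^+ N != 0 by rewrite expf_neq0 // oppr_eq0.
have h9 : A ^+ j != 0 by rewrite expf_neq0.
have -> : (-1) ^+ j * A ^+ j * (- A) ^+ N = (-1) ^+ j / A ^- j * (- A) ^+ N.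
  by field; rewrite h9.
have hs : (-1 : R) ^+ j != 0 by rewrite signr_eq0.
by field; rewrite hB h1 h2 h3 h4 h5 h6 h7 h8 h9 hs.
Qed.

End FallingBasis.

(** * Convergent real series, with the Tonelli and Fubini theorems for double series *)

Section Sums.
Context {R : realType}.
Implicit Types (u v : nat -> R) (l c : R).

(** A relation rather than a value: [limn] is total, so an equation between limits would lose the
    convergence. *)
Definition sums_to u l : Prop := series u @ \oo --> l.

Lemma sums_to_unique u l l' : sums_to u l -> sums_to u l' -> l = l'.
Proof. by move=> h h'; rewrite -(cvg_lim _ h) // (cvg_lim _ h'). Qed.

Lemma eq_sums_to u v l l' : u =1 v -> l = l' -> sums_to u l -> sums_to v l'.
Proof. by move=> /funext-> ->. Qed.

Lemma sums_toD u v l l' :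
  sums_to u l -> sums_to v l' -> sums_to (fun x => u x + v x) (l + l').
Proof.
move=> hu hv; rewrite /sums_to.
have -> : series (fun x => u x + v x) = series u \+ series v.
  by apply/funext => n; rewrite /series /= big_split.
exact: cvgD.
Qed.

Lemma sums_toZ c u l : sums_to u l -> sums_to (fun x => c * u x) (c * l).
Proof.
move=> hu; rewrite /sums_to.
have -> : series (fun x => c * u x) = (fun n => c * series u n).
  by apply/funext => n; rewrite /series /= mulr_sumr.
exact: cvgMl_tmp.
Qed.

Lemma sums_to0 : sums_to (fun _ => 0) 0.
Proof.
rewrite /sums_to (_ : series _ = fun=> 0); first exact: cvg_cst.
by apply/funext => n; rewrite /series /= big1.
Qed.

Lemma sums_to_sum n (F : nat -> nat -> R) (L : nat -> R) :
  (forall i, (i < n)%N -> sums_to (F i) (L i)) ->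
  sums_to (fun x => \sum_(i < n) F i x) (\sum_(i < n) L i).
Proof.
elim: n => [|n IHn] h.
  apply: eq_sums_to sums_to0; last by rewrite big_ord0.
  by move=> x; rewrite big_ord0.
apply: (@eq_sums_to (fun x => \sum_(i < n) F i x + F n x) _
                    (\sum_(i < n) L i + L n)).
- by move=> x; rewrite big_ord_recr.
- by rewrite big_ord_recr.
- by apply: sums_toD; [apply: IHn => i /ltnW; apply: h | apply: h].
Qed.

Lemma sums_to_finite u n :
  (forall x, (n <= x)%N -> u x = 0) -> sums_to u (\sum_(i < n) u i).
Proof.
move=> h; have E m : series u (m + n)%N = \sum_(i < n) u i.
  rewrite addnC /series /= (big_cat_nat (n := n)) ?leq_addr //= big_mkord.
  rewrite [X in _ + X]big_nat_cond [X in _ + X]big1 ?addr0 // => i.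
  by rewrite andbT => /andP[/h].
by rewrite /sums_to -(cvg_shiftn n) /= (funext E); exact: cvg_cst.
Qed.

Lemma sums_to_shift n u l : (forall x, (x < n)%N -> u x = 0) ->
  sums_to (fun x => u (n + x)%N) l <-> sums_to u l.
Proof.
move=> h; have E m : series u (m + n)%N = series (fun x => u (n + x)%N) m.
  rewrite /series /= (big_cat_nat (n := n)) ?leq_addl //=.
  rewrite big_nat_cond big1 ?add0r; last by move=> i; rewrite andbT => /andP[_ /h].
  by rewrite -{1}[n]add0n big_addn addnK; apply: eq_bigr => i _; rewrite addnC.
rewrite /sums_to -(funext E).
by rewrite -[X in _ <-> X](cvg_shiftn n).
Qed.

Lemma series_nondecreasing u : (forall x, 0 <= u x) ->
  {homo series u : m n / (m <= n)%N >-> m <= n}.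
Proof.
move=> u0 m n mn; rewrite /series /= [leRHS](big_cat_nat (n := m)) //=.
by rewrite lerDl sumr_ge0.
Qed.

Lemma series_le_sums u l n : (forall x, 0 <= u x) -> sums_to u l ->
  series u n <= l.
Proof.
move=> u0 h; rewrite -(cvg_lim _ h) //.
by apply: nondecreasing_cvgn_le; [exact: series_nondecreasing | apply/cvg_ex; exists l].
Qed.

Lemma sums_to_ge0 u l : (forall x, 0 <= u x) -> sums_to u l -> 0 <= l.
Proof.
by move=> u0 /(series_le_sums u l 0 u0); rewrite /series /= big_geq.
Qed.

Lemma sums_to_eq0 u : (forall x, 0 <= u x) -> sums_to u 0 -> forall x, u x = 0.
Proof.
move=> u0 h x; apply/eqP; rewrite eq_le u0 andbT.
apply: le_trans (series_le_sums u 0 x.+1 u0 h).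
by rewrite /series /= big_nat_recr //= lerDr sumr_ge0.
Qed.

Lemma series_le_cvg_sums u c : (forall x, 0 <= u x) ->
  (forall n, series u n <= c) -> exists2 l, sums_to u l & l <= c.
Proof.
move=> u0 uc; have cu : cvgn (series u).
  apply: nondecreasing_is_cvgn; first exact: series_nondecreasing.
  by exists c => _ [n _ <-].
exists (limn (series u)) => //.
by apply: limr_le => //; apply: nearW.
Qed.

Lemma sums_to_dominated u v l : (forall x, 0 <= u x <= v x) -> sums_to v l ->
  exists2 l', sums_to u l' & l' <= l.
Proof.
move=> uv hv; apply: series_le_cvg_sums; first by move=> x; case/andP: (uv x).
move=> n; apply: le_trans (series_le_sums v l n _ hv).
  by apply: ler_sum => i _; case/andP: (uv i).
by move=> x; case/andP: (uv x) => /le_trans; apply.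
Qed.

Lemma sums_to_le u v l l' : (forall x, u x <= v x) ->
  sums_to u l -> sums_to v l' -> l <= l'.
Proof.
move=> uv hu hv; apply: (ler_cvg_to hu hv).
by apply: nearW => n; apply: ler_sum.
Qed.

(** Half of Tonelli's theorem. Each column is dominated by [r], hence summable; a finite sum of
    columns is dominated termwise by [r], hence at most [t]. *)
Lemma tonelli_le (A : nat -> nat -> R) (r : nat -> R) t :
  (forall z x, 0 <= A z x) -> (forall z, sums_to (A z) (r z)) -> sums_to r t ->
  exists2 s, forall x, sums_to (A ^~ x) (s x) & exists2 t', sums_to s t' & t' <= t.
Proof.
move=> A0 Ar rt.
have r0 z : 0 <= r z by apply: sums_to_ge0 (Ar z).
have Ale z x : A z x <= r z.
  apply: le_trans (series_le_sums (A z) (r z) x.+1 (A0 z) (Ar z)).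
  by rewrite /series /= big_nat_recr //= lerDr sumr_ge0.
have /choice[s hs] x : exists l, sums_to (A ^~ x) l.
  have [z|l' hl' _] := sums_to_dominated (A ^~ x) r t _ rt; first by rewrite A0 Ale.
  by exists l'.
exists s => //; apply: series_le_cvg_sums.
  by move=> x; apply: sums_to_ge0 (hs x).
move=> n; rewrite /series /= big_mkord.
have h : sums_to (fun z => \sum_(x < n) A z x) (\sum_(x < n) s x).
  exact: (sums_to_sum n (fun x z => A z x) s (fun x _ => hs x)).
apply: sums_to_le h rt => z; rewrite -(big_mkord xpredT (A z)).
exact: series_le_sums.
Qed.

(** The one-sided inequality is applied to [A] and then to its transpose; uniqueness of the row sums
    closes the chain t <= t' <= t. *)
Lemma tonelli (A : nat -> nat -> R) (r : nat -> R) t :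
  (forall z x, 0 <= A z x) -> (forall z, sums_to (A z) (r z)) -> sums_to r t ->
  exists2 s, forall x, sums_to (A ^~ x) (s x) & sums_to s t.
Proof.
move=> A0 Ar rt; have [s hs [t' ht' le1]] := tonelli_le A r t A0 Ar rt.
have [r' hr' [t'' ht'' le2]] := tonelli_le (fun x z => A z x) s t' (fun x z => A0 z x) hs ht'.
exists s => //; suff -> : t = t' by [].
have rr' : r = r' by apply/funext => z; apply: sums_to_unique (Ar z) (hr' z).
have tt : t = t'' by apply: sums_to_unique rt _; rewrite rr'.
by apply/eqP; rewrite eq_le le1 tt le2.
Qed.

(** Adding [c] to [h] makes the summand nonnegative and at most [2 * c * A z x]; Tonelli's theorem
    applies to it and to [A], and [c] times the second result is subtracted. *)
Lemma fubini (A h : nat -> nat -> R) c (r : nat -> R) t :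
  (forall z x, 0 <= A z x) -> (forall z, sums_to (A z) (r z)) -> sums_to r t ->
  (forall z x, `|h z x| <= c) ->
  exists v w T, [/\ forall z, sums_to (fun x => A z x * h z x) (v z),
    forall x, sums_to (fun z => A z x * h z x) (w x), sums_to v T & sums_to w T].
Proof.
move=> A0 Ar rt hc.
pose B z x := A z x * (h z x + c).
have hB z x : 0 <= B z x <= 2 * c * A z x.
  have := hc z x; rewrite ler_norml => /andP[h1 h2].
  apply/andP; split; first by apply: mulr_ge0 => //; lra.
  by rewrite /B mulrC ler_wpM2r //; lra.
have /choice[r' hr'] z : exists l, sums_to (B z) l /\ l <= 2 * c * r z.
  have [l hl ?] := sums_to_dominated (B z) _ _ (hB z) (sums_toZ (2 * c) _ _ (Ar z)).
  by exists l.
have r'0 z : 0 <= r' z.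
  by apply: sums_to_ge0 (proj1 (hr' z)) => x; case/andP: (hB z x).
have [z|t1 ht1 _] := sums_to_dominated r' _ _ _ (sums_toZ (2 * c) r t rt).
  by rewrite r'0 (hr' z).2.
have [s1 hs1 hs1t] := tonelli B r' t1 (fun z x => proj1 (andP (hB z x)))
  (fun z => (hr' z).1) ht1.
have [s hs hst] := tonelli A r t A0 Ar rt.
exists (fun z => r' z + - c * r z), (fun x => s1 x + - c * s x), (t1 + - c * t).
have BA z x : B z x + - c * A z x = A z x * h z x by rewrite /B; ring.
split.
- move=> z; have := sums_toD _ _ _ _ (hr' z).1 (sums_toZ (- c) _ _ (Ar z)).
  by apply: eq_sums_to.
- move=> x; have := sums_toD _ _ _ _ (hs1 x) (sums_toZ (- c) _ _ (hs x)).
  by apply: eq_sums_to => // z; apply: BA.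
- exact: sums_toD ht1 (sums_toZ (- c) _ _ rt).
- exact: sums_toD hs1t (sums_toZ (- c) _ _ hst).
Qed.

End Sums.

(** * Infinite q-products, the nonterminating q-binomial theorem and the moments of [pi_lqJ] *)

Section QBinomialTheorem.
Context {R : realType} (q : R) (q01 : 0 < q < 1).
Implicit Types (a b t A B : R) (k m n x : nat).

Local Notation qp a n := (qpoch a q n).
Local Notation ef k x := (qpoch (q ^+ x) q^-1 k).

Lemma sum_qexp_le n : \sum_(i < n) q ^+ i <= (1 - q)^-1.
Proof.
have /andP[qgt0 qlt1] := q01.
have p1q : 0 < 1 - q by lra.
rewrite -[leRHS]mul1r ler_pdivlMr // mulrC.
have -> : (1 - q) * \sum_(i < n) q ^+ i = 1 - q ^+ n.
  by rewrite -opprB mulNr -subrX1 opprB.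
by have := qexp_gt0 q q01 n; lra.
Qed.

(** Bounds uniform in n, from 1 + x <= e^x and the geometric bound on the sum of the q^i. Positivity
    of the lower bound is what keeps [qpoch_oo] away from 0. *)
Lemma qpoch_bounds a : a < 1 -> exists l u : R,
  [/\ 0 < l, forall n, l <= qp a n & forall n, qp a n <= u].
Proof.
move=> a1; have /andP[qgt0 qlt1] := q01; have p1q : 0 < 1 - q by lra.
have expprod c n : \prod_(i < n) expR (c * q ^+ i) = expR (c * \sum_(i < n) q ^+ i).
  elim: n => [|n IHn]; first by rewrite !big_ord0 mulr0 expR0.
  by rewrite !big_ord_recr /= IHn mulrDr expRD.
have [a0|a0] := leP a 0.
  exists 1, (expR (- a / (1 - q))); split => // n.
    rewrite -[leLHS](@big1_eq _ _ *%R _ (index_enum 'I_n) xpredT).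
    apply: ler_prod => i _; rewrite ler01 /= lerBrDr gerDl.
    by rewrite mulr_le0_ge0 // ltW // qexp_gt0.
  apply: le_trans (_ : expR (- a * \sum_(i < n) q ^+ i) <= _); last first.
    by rewrite ler_expR ler_wpM2l ?oppr_ge0 ?sum_qexp_le.
  rewrite -expprod; apply: ler_prod => i _.
  rewrite subr_ge0 ltW ?mulr_qexp_lt1 //=.
  by rewrite -mulNr expR_ge1Dx.
have p1a : 0 < 1 - a by lra.
exists (expR (- (a / (1 - a)) / (1 - q))), 1; split => [||n].
- exact: expR_gt0.
- move=> n; apply: le_trans (_ : expR (- (a / (1 - a)) * \sum_(i < n) q ^+ i) <= _).
    by rewrite ler_expR !mulNr lerN2 ler_wpM2l ?sum_qexp_le // ltW // divr_gt0.
  rewrite -expprod; apply: ler_prod => i _; rewrite expR_ge0 /=.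
  have qi0 := qexp_gt0 q q01 i; have qi1 := qexp_le1 q q01 i.
  have h : 0 < 1 - a * q ^+ i by rewrite subr_gt0 mulr_qexp_lt1.
  rewrite mulNr expRN -[leRHS]invrK lef_pV2 ?posrE ?expR_gt0 ?invr_gt0 //.
  apply: le_trans (expR_ge1Dx _).
  (* Chord bound: s |-> 1/(1 - a s) is convex on [0, 1], so it lies below 1 + s a/(1 - a); here s =
     q^i, and the difference is computed explicitly. *)
  rewrite -subr_ge0.
  have -> : 1 + a / (1 - a) * q ^+ i - (1 - a * q ^+ i)^-1
    = a * q ^+ i * (a * (1 - q ^+ i)) / ((1 - a) * (1 - a * q ^+ i)).
    by field; rewrite !gt_eqF.
  by apply: divr_ge0; apply: mulr_ge0; try apply: mulr_ge0; lra.
- rewrite -[leRHS](@big1_eq _ _ *%R _ (index_enum 'I_n) xpredT).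
  apply: ler_prod => i _; rewrite subr_ge0 ltW ?mulr_qexp_lt1 //=.
  by rewrite gerBl mulr_ge0 // ltW // qexp_gt0.
Qed.

(** The sequence is bounded, nondecreasing for [a <= 0] and nonincreasing for [a > 0]. *)
Lemma cvg_qpoch_oo a : a < 1 -> (fun n => qp a n) @ \oo --> qpoch_oo a q.
Proof.
move=> a1; have [l [u [l0 lb ub]]] := qpoch_bounds a a1.
suff : cvgn (fun n => qp a n) by [].
have qpS n : qp a n.+1 - qp a n = - a * (qp a n * q ^+ n) by rewrite qpochSr; ring.
have p n : 0 <= qp a n * q ^+ n.
  by rewrite mulr_ge0 // ltW // ?qpoch_gt0 // qexp_gt0.
have [a0|a0] := leP a 0.
  apply: nondecreasing_is_cvgn; last by exists u => _ [n _ <-].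
  by apply/nondecreasing_seqP => n; rewrite -subr_ge0 qpS mulr_ge0 // oppr_ge0.
apply: nonincreasing_is_cvgn; last by exists l => _ [n _ <-].
apply/nonincreasing_seqP => n; rewrite -subr_le0 qpS.
by rewrite mulr_le0_ge0 // oppr_le0 ltW.
Qed.

Lemma qpoch_oo_gt0 a : a < 1 -> 0 < qpoch_oo a q.
Proof.
move=> a1; have [l [u [l0 lb ub]]] := qpoch_bounds a a1.
apply: lt_le_trans l0 _; apply: limr_ge; last exact: nearW.
by apply/cvg_ex; exists (qpoch_oo a q); apply: cvg_qpoch_oo.
Qed.

Lemma qpoch_oo_shift a n : a < 1 ->
  qpoch_oo a q = qp a n * qpoch_oo (a * q ^+ n) q.
Proof.
move=> a1; have h := cvg_qpoch_oo a a1.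
rewrite -(cvg_shiftn n) /= in h.
have h' : (fun m => qp a n * qp (a * q ^+ n) m) @ \oo
    --> qp a n * qpoch_oo (a * q ^+ n) q.
  by apply: cvgMl_tmp; exact/cvg_qpoch_oo/mulr_qexp_lt1.
rewrite -(cvg_lim _ h) // -(cvg_lim _ h') //; congr (limn _).
by apply/funext => m; rewrite addnC qpochD.
Qed.

(** The sum f(t) of the (B;q)_x t^x / (q;q)_x satisfies (1 - t) f(t) = (1 - t B) f(t q). Iteration
    from t = A, with f(A q^n) -> 1, gives the quotient of infinite products. *)
Lemma qbinomial_sum A B : 0 < A < 1 -> B < 1 ->
  sums_to (fun x => qp B x * A ^+ x / qp q x) (qpoch_oo (A * B) q / qpoch_oo A q).
Proof.
move=> /andP[A0 A1] B1; have /andP[qgt0 qlt1] := q01.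
pose c x := qp B x / qp q x.
have c0 x : 0 <= c x by rewrite divr_ge0 // ltW ?qpoch_gt0 ?qfact_gt0.
have [C C0 cC] : exists2 C, 0 <= C & forall x, c x <= C.
  have [_ [u [_ _ ub]]] := qpoch_bounds B B1.
  have [l [_ [l0 lb _]]] := qpoch_bounds q qlt1.
  have u0 : 0 <= u by apply: le_trans (ub 0%N); rewrite ltW ?qpoch_gt0.
  exists (u / l) => [|x]; first by rewrite divr_ge0 // ltW.
  by apply: ler_pM; rewrite ?invr_ge0 ?lef_pV2 ?posrE ?qfact_gt0 // ltW ?qpoch_gt0 ?qfact_gt0.
pose s t n := series (fun x => c x * t ^+ x) n.
have geom t n : 0 <= t < 1 -> \sum_(0 <= x < n) t ^+ x <= (1 - t)^-1.
  move=> /andP[t0 t1]; have p1t : 0 < 1 - t by lra.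
  rewrite big_mkord -[leRHS]mul1r ler_pdivlMr // mulrC.
  by rewrite -opprB mulNr -subrX1 opprB gerBl exprn_ge0.
(* A bound linear in [t]: it gives convergence on [0, A] and also the continuity at 0 needed for the
   limit of f(A q^n). *)
have s_ub t n : 0 <= t <= A -> s t n <= 1 + t * (C / (1 - A)).
  move=> /andP[t0 tA]; rewrite /s /series /=; case: n => [|n].
    by rewrite big_geq // addr_ge0 // mulr_ge0 // divr_ge0 //; lra.
  rewrite big_nat_recl //= /c !qpoch0 expr0 divr1 mulr1 lerD2l.
  apply: le_trans (_ : \sum_(0 <= i < n) t * (C * t ^+ i) <= _).
    apply: ler_sum => i _; rewrite -/(c i.+1) exprS mulrCA.
    by rewrite ler_wpM2l // ler_wpM2r // exprn_ge0.
  rewrite -!mulr_sumr ler_wpM2l // ler_wpM2l //.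
  apply: le_trans (geom t n _) _; first by rewrite t0 /=; lra.
  by rewrite lef_pV2 ?posrE; lra.
(* Outside [0, A] the value of [f] is unconstrained. *)
have /choice[f hf] t : exists l, 0 <= t <= A ->
    sums_to (fun x => c x * t ^+ x) l /\ 1 <= l <= 1 + t * (C / (1 - A)).
  have [tA|] := boolP (0 <= t <= A); last by exists 0.
  have t0 : 0 <= t by case/andP: tA.
  have p x : 0 <= c x * t ^+ x by rewrite mulr_ge0 // exprn_ge0.
  have [l hl le] := series_le_cvg_sums _ _ p (fun n => s_ub t n tA).
  exists l => _; split => //; rewrite le andbT.
  apply: le_trans (series_le_sums _ _ 1 p hl).
  by rewrite /series /= big_nat1 /c !qpoch0 expr0 mulr1 divr1.
have cS n : c n.+1 * (1 - q ^+ n.+1) = c n * (1 - B * q ^+ n).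
  rewrite /c !qpochSr -exprS.
  have h := qfact_neq0 q q01 n.+1; move: h; rewrite qpochSr -exprS.
  rewrite mulf_eq0 negb_or => /andP[h1 h2].
  by field; rewrite h1 h2.
(* (1 - t) f(t) = (1 - t B) f(q t) for the sum f, up to the last term *)
have s_rec t n : (1 - t) * s t n
    = (1 - t * B) * s (t * q) n - c n * (1 - q ^+ n) * t ^+ n.
  rewrite /s /series /=; elim: n => [|n IHn].
    by rewrite !big_geq // expr0; ring.
  rewrite ![\sum_(0 <= k < n.+1) _]big_nat_recr //= 2!mulrDr IHn cS exprMn exprS.
  ring.
have f_rec t : 0 <= t <= A -> (1 - t) * f t = (1 - t * B) * f (t * q).
  move=> tA; have [ht _] := hf t tA.
  have tqA : 0 <= t * q <= A by apply/andP; split; nra.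
  have [htq _] := hf (t * q) tqA.
  have e1 : (fun n => (1 - t) * s t n) @ \oo --> (1 - t) * f t by exact: cvgMl_tmp.
  apply: (cvg_unique _ e1); rewrite // (funext (s_rec t)) /=.
  rewrite -[X in _ --> X]subr0; apply: cvgB; first exact: cvgMl_tmp.
  apply: (@squeeze_cvgr _ _ _ _ (fun=> 0) (fun n => C * t ^+ n)).
  - apply: nearW => n; have qn0 := qexp_gt0 q q01 n; have qn1 := qexp_le1 q q01 n.
    have tn : 0 <= t ^+ n by rewrite exprn_ge0 //; lra.
    have c0n := c0 n; apply/andP; split.
      by rewrite mulr_ge0 // mulr_ge0 // subr_ge0.
    rewrite ler_wpM2r //.
    by apply: le_trans (cC n); rewrite ler_piMr //; lra.
  - exact: cvg_cst.
  - by apply: cvg_geometric; rewrite ger0_norm; lra.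
have f_iter n : qp A n * f A = qp (A * B) n * f (A * q ^+ n).
  elim: n => [|n IHn]; first by rewrite !qpoch0 expr0 mulr1.
  rewrite qpochSr mulrAC IHn -mulrA [f _ * _]mulrC f_rec; last first.
    by have := qexp_gt0 q q01 n; have := qexp_le1 q q01 n; nra.
  by rewrite qpochSr exprSr -!mulrA; congr (_ * (_ * _)); ring.
have f_lim : (fun n => f (A * q ^+ n)) @ \oo --> (1 : R).
  have bd n : 0 <= A * q ^+ n <= A.
    by have := qexp_gt0 q q01 n; have := qexp_le1 q q01 n; nra.
  apply: (@squeeze_cvgr _ _ _ _ (fun=> 1)
            (fun n => 1 + A * (C / (1 - A)) * q ^+ n)).
  - by apply: nearW => n; have [_] := hf _ (bd n); rewrite mulrAC.
  - exact: cvg_cst.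
  - rewrite -[X in _ --> X]addr0; apply: cvgD; first exact: cvg_cst.
    by apply: cvg_geometric; rewrite ger0_norm; lra.
have AA : 0 <= A <= A by lra.
have AB1 : A * B < 1 by nra.
apply: eq_sums_to (hf A AA).1.
  by move=> x; rewrite /c mulrAC.
apply: (mulfI (lt0r_neq0 (qpoch_oo_gt0 A A1))).
rewrite mulrCA divff ?mulr1 ?gt_eqF ?qpoch_oo_gt0 //.
have h1 : (fun n => qp A n * f A) @ \oo --> qpoch_oo A q * f A.
  by apply: cvgMr_tmp; exact: cvg_qpoch_oo.
have h2 : (fun n => qp (A * B) n * f (A * q ^+ n)) @ \oo --> qpoch_oo (A * B) q.
  rewrite -[X in _ --> X]mulr1; apply: (cvgM _ f_lim).
  exact: cvg_qpoch_oo.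
by apply: (cvg_unique _ h1); rewrite // (funext f_iter).
Qed.

(** The falling factorial kills x < k and shifts the rest, turning [B] into [B * q ^+ k]; the power
    turns [A] into [A * q ^+ r]. What remains is [qbinomial_sum]. The case k = 0 handles pure
    powers, and the mixed case serves orthogonality. *)
Lemma pi_lqJ_moment A B r k : 0 < A < 1 -> B < 1 ->
  sums_to (fun x => pi_lqJ q x A B * (q ^+ r) ^+ x * ef k x)
          (qp B k * A ^+ k * (q ^+ r) ^+ k * qp A r / qp (A * B) (k + r)).
Proof.
move=> A01 B1; have /andP[A0 A1] := A01.
have AB1 : A * B < 1 by nra.
apply/(sums_to_shift k) => [x xk|]; first by rewrite qfall_small ?mulr0.
have Ar01 : 0 < A * q ^+ r < 1 by rewrite mulr_gt0 ?qexp_gt0 ?mulr_qexp_lt1.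
have := sums_toZ (qp B k * A ^+ k * (q ^+ r) ^+ k
  * (qpoch_oo A q / qpoch_oo (A * B) q)) _ _
  (qbinomial_sum _ _ Ar01 (mulr_qexp_lt1 q q01 B k B1)).
apply: eq_sums_to => [x|].
  rewrite /pi_lqJ qfallE ?leq_addr // addKn (qpochD q B) !exprD exprMn.
  have h1 := qfact_neq0 q q01 (k + x); have h2 := qfact_neq0 q q01 x.
  have h3 := gt_eqF (qpoch_oo_gt0 _ AB1).
  by field; rewrite h1 h2 h3.
rewrite (qpoch_oo_shift A r A1) (qpoch_oo_shift (A * B) (k + r) AB1).
have -> : A * q ^+ r * (B * q ^+ k) = A * B * q ^+ (k + r) by rewrite exprD; ring.
have h1 := gt_eqF (qpoch_oo_gt0 _ (mulr_qexp_lt1 q q01 A r A1)).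
have h2 := gt_eqF (qpoch_oo_gt0 _ (mulr_qexp_lt1 q q01 _ (k + r) AB1)).
have h3 := gt_eqF (qpoch_gt0 q q01 (A * B) (k + r) AB1).
by field; rewrite h1 h2 h3.
Qed.

End QBinomialTheorem.

(** * The two intertwining operators between little q-Jacobi systems, and cases (i) and (iii) *)

Section Intertwiners.
Context {R : realType} (q : R) (q01 : 0 < q < 1).
Implicit Types (a b c t A B C : R) (f g : nat -> R) (k m n x y z w : nat).

Local Notation qp a n := (qpoch a q n).
Local Notation ef k x := (qpoch (q ^+ x) q^-1 k).

Lemma mulr_lt1 a b : 0 < a < 1 -> b < 1 -> a * b < 1.
Proof. nra. Qed.

Lemma mulr_itv01 a b : 0 < a < 1 -> 0 < b < 1 -> 0 < a * b < 1.
Proof. nra. Qed.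

Lemma pi_lqJ_gt0 x a b : 0 < a < 1 -> b < 1 -> 0 < pi_lqJ q x a b.
Proof.
move=> a01 b1; have /andP[a0 a1] := a01.
have ab1 := mulr_lt1 a b a01 b1; rewrite /pi_lqJ.
apply: mulr_gt0;
  apply: divr_gt0;
  rewrite ?mulr_gt0 ?qfact_gt0 ?qpoch_gt0 ?exprn_gt0 ?qpoch_oo_gt0 //.
Qed.

Lemma pi_lqJ_sum1 a b : 0 < a < 1 -> b < 1 -> sums_to (fun x => pi_lqJ q x a b) 1.
Proof.
move=> a01 b1; have := pi_lqJ_moment q q01 a b 0 0 a01 b1.
by apply: eq_sums_to => [x|]; rewrite !qpoch0 !expr0 ?expr1n ?mulr1 ?divr1.
Qed.

Lemma pi_aqH_ge0 x M a b : 0 < a < 1 -> b < 1 -> 0 <= pi_aqH q x M a b.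
Proof.
move=> a01 b1; have /andP[a0 a1] := a01; have ab1 := mulr_lt1 a b a01 b1.
rewrite /pi_aqH ltW //; apply: mulr_gt0; apply: divr_gt0;
  rewrite ?mulr_gt0 ?qfact_gt0 ?qpoch_gt0 ?exprn_gt0 //.
Qed.

(* If y ~ pi_lqJ(c, a b) and z given y ~ pi_aqH(a, b), then z and y - z are
   independent. *)
Lemma pi_lqJ_split y z a b c : 0 < a < 1 -> b < 1 -> 0 < c < 1 -> (z <= y)%N ->
  pi_lqJ q y c (a * b) * pi_aqH q z y a b
  = pi_lqJ q z (c * a) b * pi_lqJ q (y - z) c a.
Proof.
move=> a01 b1 c01 zy; have /andP[a0 a1] := a01; have /andP[c0 c1] := c01.
have ab1 := mulr_lt1 a b a01 b1; have ca1 := mulr_lt1 c a c01 a1.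
have cab1 := mulr_lt1 c (a * b) c01 ab1.
have [d ->] : exists d, y = (z + d)%N by exists (y - z)%N; rewrite subnKC.
rewrite /pi_lqJ /pi_aqH addKn exprD exprMn -[c * a * b]mulrA.
have h1 := gt_eqF (qpoch_oo_gt0 q q01 _ ca1).
have h2 := gt_eqF (qpoch_oo_gt0 q q01 _ cab1).
have h3 := gt_eqF (qpoch_gt0 q q01 _ (z + d) ab1).
have h4 := qfact_neq0 q q01 z; have h5 := qfact_neq0 q q01 d.
have h6 := qfact_neq0 q q01 (z + d).
by field; rewrite h1 h2 h3 h4 h5 h6.
Qed.

(** The terms with z < k vanish; after a shift by [k] the rest is [qVandermonde] at level y - k with
    parameters [a] and [b * q ^+ k]. *)
Lemma pi_aqH_qfall k y a b : 0 < a < 1 -> b < 1 ->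
  \sum_(z < y.+1) pi_aqH q z y a b * ef k z
  = a ^+ k * qp b k / qp (a * b) k * ef k y.
Proof.
move=> a01 b1; have ab1 := mulr_lt1 a b a01 b1.
have [yk|ky] := ltnP y k.
  rewrite (qfall_small q q01 k y yk) mulr0 big1 // => -[z /= zy] _.
  by rewrite qfall_small ?mulr0 //; lia.
have [d ->] : exists d, y = (k + d)%N by exists (y - k)%N; rewrite subnKC.
rewrite -addnS big_split_ord /= big1 ?add0r => [|i _]; last first.
  by rewrite qfall_small ?mulr0.
have h1 := gt_eqF (qpoch_gt0 q q01 _ k ab1).
have h2 := gt_eqF (qpoch_gt0 q q01 _ d (mulr_qexp_lt1 q q01 _ k ab1)).
have h := qfact_neq0 q q01.
(* Multiplied and divided by (a b q^k;q)_d, to exhibit the value of [qVandermonde]. *)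
have -> : a ^+ k * qp b k / qp (a * b) k * ef k (k + d)
    = a ^+ k * qp b k / qp (a * b) k * ef k (k + d)
      / qp (a * b * q ^+ k) d * qp (a * (b * q ^+ k)) d.
  by rewrite [a * (b * _)]mulrA; field; rewrite h1 h2.
rewrite -(qVandermonde q q01 d a (b * q ^+ k)) mulr_sumr; apply: eq_bigr => -[m /= md] _.
rewrite !qfallE ?leq_addr // !addKn qbinE // /pi_aqH subnDl.
rewrite (qpochD q b k m) (qpochD q (a * b) k d) exprD.
by field; rewrite h1 h2 !h.
Qed.

Lemma pi_aqH_sum1 y a b : 0 < a < 1 -> b < 1 ->
  \sum_(z < y.+1) pi_aqH q z y a b = 1.
Proof.
move=> a01 b1; have := pi_aqH_qfall 0 y a b a01 b1.
rewrite !qpoch0 expr0 !mulr1 divr1 => <-.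
by apply: eq_bigr => z _; rewrite qpoch0 mulr1.
Qed.

(** In the falling factorial basis both polynomials share the parameter c a b q^{n-1}, and the
    eigenvalue a^k (b;q)_k / (ab;q)_k turns one list of coefficients into the other. *)
Lemma pi_aqH_P_lqJ n y a b c : 0 < a < 1 -> b < 1 -> 0 < c < 1 ->
  \sum_(z < y.+1) pi_aqH q z y a b * P_lqJ q n z (c * a) b
  = P_lqJ q n y c (a * b).
Proof.
move=> a01 b1 c01; have ab1 := mulr_lt1 a b a01 b1.
have ca01 := mulr_itv01 c a c01 a01.
rewrite P_lqJ_qfall //.
under eq_bigr => z _ do rewrite P_lqJ_qfall // mulr_sumr.
rewrite exchange_big /=; apply: eq_bigr => k _.
under eq_bigr => z _ do rewrite mulrCA.
rewrite -mulr_sumr pi_aqH_qfall // !exprMn !exprVn -[c * a * b]mulrA exprMn.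
have h1 := gt_eqF (qpoch_gt0 q q01 _ k ab1).
have h2 := gt_eqF (qpoch_gt0 q q01 _ k b1).
have h3 := qfact_neq0 q q01 k.
have h4 : a ^+ k != 0 by rewrite expf_neq0 // gt_eqF //; case/andP: a01.
have h5 : c ^+ k != 0 by rewrite expf_neq0 // gt_eqF //; case/andP: c01.
by field; rewrite h1 h2 h3 h4 h5.
Qed.

(** In the basis of powers, the moment (c;q)_k / (ca;q)_k converts the coefficients; [kappa_i] is
    the quotient of the two normalising prefactors. *)
Lemma pi_lqJ_P_lqJ n z a b c : 0 < a < 1 -> b < 1 -> 0 < c < 1 ->
  sums_to (fun w => pi_lqJ q w c a * P_lqJ q n (z + w) c (a * b))
          (kappa_i q a b c n * P_lqJ q n z (c * a) b).
Proof.
move=> a01 b1 c01; have /andP[a0 a1] := a01; have /andP[c0 c1] := c01.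
have ab1 := mulr_lt1 a b a01 b1.
have ca1 := mulr_lt1 c a c01 a1.
rewrite /P_lqJ.
set pref := (- c) ^- n * _ * _.
pose co k := qp (q ^- n) k * qp (c * (a * b) * q ^ (n%:Z - 1)) k.
have h k := sums_toZ (pref * (co k / (qp c k * qp q k) * q ^+ (z.+1 * k))) _ _
  (pi_lqJ_moment q q01 c a k 0 c01 a1).
have := sums_to_sum n.+1 _ _ (fun k _ => h k).
apply: eq_sums_to => [w|].
  rewrite [RHS]mulrCA 2!mulr_sumr; apply: eq_bigr => k _.
  rewrite qpoch0 -/(co k) -addSn mulnDl exprD -exprM [(k * w)%N]mulnC.
  ring.
rewrite [in RHS]mulrA mulr_sumr; apply: eq_bigr => -[k /= _] _.
have -> : c * a * b = c * (a * b) by ring.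
rewrite -/(co k) /pref /kappa_i !qpoch0 !expr0 add0n (mulrC c a).
rewrite -mulrN exprMn.
have C1 m := gt_eqF (qpoch_gt0 q q01 _ m c1).
have C2 m := gt_eqF (qpoch_gt0 q q01 _ m ca1).
have C3 m := gt_eqF (qpoch_gt0 q q01 _ m ab1).
have C4 m := gt_eqF (qpoch_gt0 q q01 _ m b1).
have C5 m := qfact_neq0 q q01 m.
have C6 : a ^+ n != 0 by rewrite expf_neq0 // gt_eqF.
have C7 : (- c) ^+ n != 0 by rewrite expf_neq0 // oppr_eq0 gt_eqF.
have C8 := qexp_neq0 q q01 'C(n, 2).
rewrite mulrC in C2.
by field; rewrite !C1 !C2 !C3 !C4 !C5 C6 C7 C8.
Qed.

(** Supplies the bound that [fubini] requires for these signed functions. *)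
Lemma P_lqJ_bounded n a b : exists C, forall x, `|P_lqJ q n x a b| <= C.
Proof.
rewrite /P_lqJ; set pref := (- a) ^- n * _ * _.
pose co (k : nat) := qp (q ^- n) k * qp (a * b * q ^ (n%:Z - 1)) k / (qp a k * qp q k).
exists (`|pref| * \sum_(k < n.+1) `|co k|) => x.
rewrite normrM ler_wpM2l //; apply: le_trans (ler_norm_sum _ _ _) _.
apply: ler_sum => k _; rewrite normrM -/(co k) ler_piMr //.
by rewrite ger0_norm ?qexp_le1 // ltW // qexp_gt0.
Qed.

(** Reversibility rewrites K(x,y) pi(y) as K(y,x) pi(x), so the eigenvalue equation reduces to one
    for the mean of [P_lqJ] under K(., x). *)
Lemma lqJ_solvableI a b (K : nat -> nat -> R) (kappa : nat -> R) :
  0 < a < 1 -> b < 1 ->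
  (forall x y, 0 <= K x y) ->
  (forall y, sums_to (K ^~ y) 1) ->
  (forall x y, K x y * pi_lqJ q y a b = K y x * pi_lqJ q x a b) ->
  (forall n y, sums_to (fun x => K x y * P_lqJ q n x a b)
                       (kappa n * P_lqJ q n y a b)) ->
  lqJ_solvable q a b K kappa.
Proof.
move=> a01 b1 K0 K1 Krev KP; split => // x n.
have := sums_toZ (pi_lqJ q x a b) _ _ (KP n x).
apply: eq_sums_to => [y|]; last by ring.
by rewrite Krev; ring.
Qed.

(** The kernel that picks z <= y with weight [g z], then w with weight [K z w], and moves to x = z +
    w; [minn x y] records z <= x and z <= y. Cases (i) and (iv) both have this form. *)
Lemma sums_to_mixture y g (K : nat -> nat -> R) f (v : nat -> R) :
  (forall z, (z <= y)%N -> sums_to (fun w => K z w * f (z + w)%N) (v z)) ->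
  sums_to (fun x => (\sum_(0 <= z < (minn x y).+1) g z * K z (x - z)%N) * f x)
          (\sum_(z < y.+1) g z * v z).
Proof.
move=> h.
pose F z x := if (z <= x)%N then g z * (K z (x - z)%N * f x) else 0.
apply: (@eq_sums_to _ (fun x => \sum_(z < y.+1) F z x) _
          (\sum_(z < y.+1) g z * v z)) => //.
  move=> x; rewrite -(big_mkord xpredT (F ^~ x)) /F -big_mkcond /= mulr_suml.
  rewrite [RHS](big_nat_widen _ _ y.+1) ?ltnS ?geq_minr //.
  rewrite [LHS]big_nat_cond [RHS]big_nat_cond.
  apply: eq_big => [z|z _]; last by rewrite mulrA.
  by rewrite /= !ltnS leq_min; case: (leqP z y); rewrite ?andbF ?andbT.
apply: (sums_to_sum y.+1 F (fun z => g z * v z)) => z zy.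
apply/(sums_to_shift z) => [x xz|]; first by rewrite /F leqNgt xz.
apply: eq_sums_to (sums_toZ (g z) _ _ (h z zy)) => // w.
by rewrite /F leq_addr addKn.
Qed.

Lemma series_from m (F : nat -> R) :
  series (fun z => if (m <= z)%N then F z else 0)
  = (fun N => \sum_(m <= z < N) F z).
Proof.
apply/funext => N; rewrite /series /= -big_mkcond.
by rewrite [RHS](big_nat_widenl _ 0).
Qed.

Lemma K_i_solvable a b c : 0 < a < 1 -> b < 1 -> 0 < c < 1 ->
  lqJ_solvable q c (a * b) (K_i q a b c) (kappa_i q a b c).
Proof.
move=> a01 b1 c01; have /andP[a0 a1] := a01; have ab1 := mulr_lt1 a b a01 b1.
have KE f v y : (forall z, (z <= y)%N ->
    sums_to (fun w => pi_lqJ q w c a * f (z + w)%N) (v z)) ->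
  sums_to (fun x => K_i q a b c x y * f x) (\sum_(z < y.+1) pi_aqH q z y a b * v z).
  move=> /(sums_to_mixture y (fun z => pi_aqH q z y a b) (fun _ w => pi_lqJ q w c a)).
  apply: eq_sums_to => // x; congr (_ * _); apply: eq_bigr => z _.
  by rewrite mulrC.
apply: lqJ_solvableI => //.
- move=> x y; apply: sumr_ge0 => z _.
  by rewrite mulr_ge0 ?pi_aqH_ge0 // ltW // pi_lqJ_gt0.
- have T1 : sums_to (fun w => pi_lqJ q w c a * 1) 1.
    by apply: eq_sums_to (pi_lqJ_sum1 c a c01 a1) => // x; rewrite mulr1.
  move=> y; have := KE (fun=> 1) (fun=> 1) y (fun z _ => T1).
  apply: eq_sums_to => [x|]; first by rewrite mulr1.
  by rewrite -mulr_suml mulr1 pi_aqH_sum1.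
(* Reversibility holds for each z: by [pi_lqJ_split] both sides become [pi_lqJ q z (c * a) b] times
   the two weights at x - z and y - z. *)
- move=> x y; rewrite /K_i minnC !mulr_suml !big_nat; apply: eq_bigr => z.
  rewrite ltnS leq_min => /and3P[_ zy zx].
  rewrite -(mulrA (pi_lqJ q (x - z) c a)) -(mulrA (pi_lqJ q (y - z) c a)).
  by rewrite ![pi_aqH q z _ a b * _]mulrC !pi_lqJ_split //; ring.
- move=> n y; rewrite -(pi_aqH_P_lqJ n y a b c a01 b1 c01) mulr_sumr.
  have := KE (fun x => P_lqJ q n x c (a * b)) _ y (fun z _ => pi_lqJ_P_lqJ n z a b c a01 b1 c01).
  by apply: eq_sums_to => //; apply: eq_bigr => z _; rewrite mulrCA.
Qed.

(** By [pi_lqJ_split] both sides equal [pi_lqJ q z a (b * c)] times the [pi_aqH] weights of x and y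
    given z. *)
Lemma K_iii_term_swap x y z a b c : 0 < a < 1 -> 0 < b < 1 -> c < 1 ->
  (maxn x y <= z)%N ->
  K_iii_term q a b c x y z * pi_lqJ q y (a * b) c
  = K_iii_term q a b c y x z * pi_lqJ q x (a * b) c.
Proof.
move=> a01 b01 c1; rewrite geq_max => /andP[xz yz]; rewrite /K_iii_term.
rewrite -(mulrA (pi_aqH q x z b c)) -(mulrA (pi_aqH q y z b c)).
rewrite ![pi_lqJ q (z - _) a b * _]mulrC -!pi_lqJ_split //; ring.
Qed.

Lemma K_iii_cvgE x y a b c l :
  sums_to (fun z => if (maxn x y <= z)%N then K_iii_term q a b c x y z else 0) l ->
  K_iii q a b c x y = l /\
  cvgn (fun N => \sum_(maxn x y <= z < N) K_iii_term q a b c x y z).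
Proof.
rewrite /sums_to series_from => h; split; first exact: cvg_lim h.
by apply/cvg_ex; exists l.
Qed.

(** From y, jump up to z with law [r], then down to x; [J z x] is the joint weight. Its total mass
    is 1, so Tonelli gives convergence of the sums over z that define [K_iii], and Fubini exchanges
    the sums against the bounded [f]. *)
Lemma K_iii_sums y a b c f C v : 0 < a < 1 -> 0 < b < 1 -> c < 1 ->
  (forall x, `|f x| <= C) ->
  sums_to (fun w => pi_lqJ q w a b
               * \sum_(x < (y + w).+1) pi_aqH q x (y + w) b c * f x) v ->
  [/\ forall x, sums_to (fun z =>
        if (maxn x y <= z)%N then K_iii_term q a b c x y z else 0) (K_iii q a b c x y)
    & sums_to (fun x => K_iii q a b c x y * f x) v].
Proof.
move=> a01 b01 c1 fC hv; have b1 : b < 1 by case/andP: b01.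
(* The guard removes z < x and z < y, where truncated subtraction would give junk values. *)
pose J z x := if (maxn x y <= z)%N then K_iii_term q a b c x y z else 0.
have J0 z x : 0 <= J z x.
  rewrite /J; case: ifP => // _.
  by rewrite mulr_ge0 ?pi_aqH_ge0 // ltW // pi_lqJ_gt0.
pose r z := if (y <= z)%N then pi_lqJ q (z - y) a b else 0.
have JS g z : sums_to (fun x => J z x * g x)
    (r z * \sum_(x < z.+1) pi_aqH q x z b c * g x).
  have J_small x : (z.+1 <= x)%N -> J z x * g x = 0.
    by move=> zx; rewrite /J geq_max leqNgt zx mul0r.
  apply: eq_sums_to (sums_to_finite _ _ J_small) => //.
  rewrite mulr_sumr; apply: eq_bigr => -[x /= xz] _.
  rewrite /J /r geq_max -ltnS xz /=; case: ifP => _; last by rewrite !mul0r.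
  by rewrite /K_iii_term mulrAC mulrC.
have Jr z : sums_to (J z) (r z).
  apply: eq_sums_to (JS (fun=> 1) z) => [x|]; first by rewrite mulr1.
  by rewrite -mulr_suml mulr1 pi_aqH_sum1 // mulr1.
have r_shift g l : sums_to (fun w => pi_lqJ q w a b * g (y + w)%N) l ->
    sums_to (fun z => r z * g z) l.
  move=> h; apply/(sums_to_shift y) => [x xy|]; first by rewrite /r leqNgt xy mul0r.
  by apply: eq_sums_to h => // w; rewrite /r leq_addr addKn.
have r1 : sums_to r 1.
  apply: eq_sums_to (r_shift (fun=> 1) 1 _) => // [x|]; first by rewrite mulr1.
  by apply: eq_sums_to (pi_lqJ_sum1 a b a01 b1) => // x; rewrite mulr1.
have [s sJ _] := tonelli J r 1 J0 Jr r1.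
have KJ x : sums_to (J ^~ x) (K_iii q a b c x y).
  by have [-> _] := K_iii_cvgE _ _ _ _ _ _ (sJ x).
split=> //.
have [v' [w [T [hv' hw hT hT']]]] := fubini J (fun _ x => f x) C r 1 J0 Jr r1 (fun _ => fC).
apply: eq_sums_to hT' => [x|].
  apply: sums_to_unique (hw x) _.
  by apply: eq_sums_to (sums_toZ (f x) _ _ (KJ x)) => [z|]; rewrite mulrC.
apply: sums_to_unique hT _.
apply: eq_sums_to (r_shift (fun z => \sum_(x < z.+1) pi_aqH q x z b c * f x) v hv) => // z.
exact: sums_to_unique (JS f z) (hv' z).
Qed.

Lemma K_iii_expectation y a b c f C v : 0 < a < 1 -> 0 < b < 1 -> c < 1 ->
  (forall x, `|f x| <= C) ->
  sums_to (fun w => pi_lqJ q w a b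
               * \sum_(x < (y + w).+1) pi_aqH q x (y + w) b c * f x) v ->
  sums_to (fun x => K_iii q a b c x y * f x) v.
Proof. by move=> a01 b01 c1 fC /(K_iii_sums _ _ _ _ _ _ _ a01 b01 c1 fC)[]. Qed.

Lemma K_iii_sum1 y a b c : 0 < a < 1 -> 0 < b < 1 -> c < 1 ->
  (forall x, sums_to (fun z =>
        if (maxn x y <= z)%N then K_iii_term q a b c x y z else 0) (K_iii q a b c x y))
  /\ sums_to (fun x => K_iii q a b c x y * 1) 1.
Proof.
move=> a01 b01 c1; have b1 : b < 1 by case/andP: b01.
have [||? ?] := K_iii_sums y a b c (fun=> 1) 1 1 a01 b01 c1.
- by move=> x; rewrite normr1.
- apply: eq_sums_to (pi_lqJ_sum1 a b a01 b1) => // w.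
  by rewrite -mulr_suml mulr1 pi_aqH_sum1 // mulr1.
- by split.
Qed.

Lemma K_iii_ge0 x y a b c : 0 < a < 1 -> 0 < b < 1 -> c < 1 ->
  0 <= K_iii q a b c x y.
Proof.
move=> a01 b01 c1; have [h _] := K_iii_sum1 y a b c a01 b01 c1.
apply: sums_to_ge0 (h x) => z; case: ifP => // _.
have b1 : b < 1 by case/andP: b01.
by rewrite mulr_ge0 ?pi_aqH_ge0 // ltW // pi_lqJ_gt0.
Qed.

Lemma K_iii_reversible x y a b c : 0 < a < 1 -> 0 < b < 1 -> c < 1 ->
  K_iii q a b c x y * pi_lqJ q y (a * b) c
  = K_iii q a b c y x * pi_lqJ q x (a * b) c.
Proof.
move=> a01 b01 c1.
have [hy _] := K_iii_sum1 y a b c a01 b01 c1.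
have [hx _] := K_iii_sum1 x a b c a01 b01 c1.
have h1 := sums_toZ (pi_lqJ q y (a * b) c) _ _ (hy x).
have h2 := sums_toZ (pi_lqJ q x (a * b) c) _ _ (hx y).
rewrite mulrC [RHS]mulrC; apply: sums_to_unique h1 _.
apply: eq_sums_to h2 => // z; rewrite maxnC; case: ifP => xyz; last by rewrite !mulr0.
by rewrite mulrC -K_iii_term_swap 1?mulrC // maxnC.
Qed.

Lemma K_iii_solvable a b c : 0 < a < 1 -> 0 < b < 1 -> c < 1 ->
  (forall x y,
     cvgn (fun N => \sum_(maxn x y <= z < N) K_iii_term q a b c x y z))
  /\ lqJ_solvable q (a * b) c (K_iii q a b c) (kappa_iii q a b c).
Proof.
move=> a01 b01 c1; have b1 : b < 1 by case/andP: b01.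
have ab01 := mulr_itv01 a b a01 b01.
split=> [x y|].
  have [h _] := K_iii_sum1 y a b c a01 b01 c1.
  by have [_] := K_iii_cvgE _ _ _ _ _ _ (h x).
apply: lqJ_solvableI => //.
- by move=> x y; apply: K_iii_ge0.
- move=> y; have [_] := K_iii_sum1 y a b c a01 b01 c1.
  by apply: eq_sums_to => // x; rewrite mulr1.
- by move=> x y; apply: K_iii_reversible.
move=> n y; have [C PC] := P_lqJ_bounded n (a * b) c.
apply: (K_iii_expectation y a b c (fun x => P_lqJ q n x (a * b) c) C _ a01 b01 c1 PC).
have := pi_lqJ_P_lqJ n y b c a b01 c1 a01.
apply: eq_sums_to => [w|].
  by rewrite pi_aqH_P_lqJ.
by rewrite /kappa_i /kappa_iii (mulrC b a) (mulrC (qp c n)) (mulrC (qp (b * c) n)).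
Qed.

End Intertwiners.

(** * Polynomials in q^x, orthogonality, and the characterisation of [P_lqJ] by it *)

Section PolynomialsInQx.
Context {R : realType} (q : R) (q01 : 0 < q < 1).
Implicit Types (a b c t A B C : R) (f g r : nat -> R) (j k m n x y z w : nat).

Local Notation qp a n := (qpoch a q n).
Local Notation ef k x := (qpoch (q ^+ x) q^-1 k).

Let q0 := qbase_neq0 q q01.

(** Here [n] bounds the size of the polynomial, so the degree is strictly less than [n]. *)
Definition qpoly n f : Prop :=
  exists2 p : {poly R}, (size p <= n)%N & forall x, f x = p.[q ^+ x].

Lemma qpoly_leq m n f : (m <= n)%N -> qpoly m f -> qpoly n f.
Proof. by move=> mn [p pm fp]; exists p => //; apply: leq_trans mn. Qed.

Lemma eq_qpoly n f g : f =1 g -> qpoly n f -> qpoly n g.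
Proof. by move=> fg [p pn fp]; exists p => // x; rewrite -fg. Qed.

Lemma qpoly_sum n m (c : nat -> R) (F : nat -> nat -> R) :
  (forall i, (i < m)%N -> qpoly n (F i)) ->
  qpoly n (fun x => \sum_(i < m) c i * F i x).
Proof.
elim: m => [|m IHm] h.
  by exists 0 => [|x]; rewrite ?size_poly0 // horner0 big_ord0.
have [i im|p pn hp] := IHm; first exact/h/ltnW.
have [p' pn' hp'] := h m (ltnSn m).
exists (p + c m *: p') => [|x].
  rewrite (leq_trans (size_polyD _ _)) // geq_max pn.
  exact: leq_trans (size_scale_leq _ _) pn'.
by rewrite big_ord_recr /= hp hp' hornerD hornerZ.
Qed.

Lemma qpoly_expM n k f : qpoly n f -> qpoly (n + k) (fun x => (q ^+ k) ^+ x * f x).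
Proof.
move=> [p pn hp]; exists ('X^k * p) => [|x].
  by rewrite (leq_trans (size_polyMleq _ _)) // size_polyXn addSn addnC leq_add2r.
by rewrite hornerM hornerXn hp -!exprM mulnC.
Qed.

Lemma qpoly_qfall k : qpoly k.+1 (fun x => ef k x).
Proof.
elim: k => [|k [p pk hp]].
  by exists 1 => [|x]; rewrite ?size_poly1 // qpoch0 hornerE.
exists (p * (1 - (q^-1 ^+ k) *: 'X)) => [|x].
  rewrite (leq_trans (size_polyMleq _ _)) //.
  have h : (size (1 - (q^-1 ^+ k) *: 'X : {poly R})%R <= 2)%N.
    rewrite (leq_trans (size_polyD _ _)) // size_poly1 size_polyN geq_max /=.
    by rewrite (leq_trans (size_scale_leq _ _)) // size_polyX.
  by rewrite -subn1 leq_subLR (leq_trans (leq_add pk h)) // addn2 add1n.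
by rewrite qpochSr hp hornerM !hornerE [q ^+ x * _]mulrC.
Qed.

Lemma qpoly_coef n f : qpoly n f ->
  exists c : nat -> R, forall x, f x = \sum_(k < n) c k * (q ^+ k) ^+ x.
Proof.
move=> [p pn hp]; exists (fun k => p`_k) => x.
rewrite hp (horner_coef_wide _ pn); apply: eq_bigr => k _.
by rewrite -!exprM mulnC.
Qed.

Lemma qpoly_bounded n f : qpoly n f -> exists C, forall x, `|f x| <= C.
Proof.
move=> /qpoly_coef[c fE]; exists (\sum_(k < n) `|c k|) => x.
rewrite fE (le_trans (ler_norm_sum _ _ _)) //; apply: ler_sum => k _.
by rewrite normrM ler_piMr // -exprM ger0_norm ?qexp_le1 // ltW // qexp_gt0.
Qed.

(** Powers are expanded in falling factorials, on which the operator is diagonal; hence the degree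
    does not grow. *)
Lemma pi_aqH_qpoly n a b f : 0 < a < 1 -> b < 1 -> qpoly n f ->
  qpoly n (fun y => \sum_(z < y.+1) pi_aqH q z y a b * f z).
Proof.
move=> a01 b1 /qpoly_coef[c fE].
apply: (eq_qpoly _ (fun y => \sum_(k < n) c k *
    \sum_(j < k.+1) (qbin q k j * ((-1) ^+ j * q ^+ 'C(j, 2))
                     * (a ^+ j * qp b j / qp (a * b) j)) * ef j y)).
  move=> y; under [RHS]eq_bigr => z _ do rewrite fE mulr_sumr.
  rewrite [RHS]exchange_big /=; apply: eq_bigr => k _.
  under [RHS]eq_bigr => z _.
    rewrite mulrCA -exprM mulnC exprM (exp_qfall q q01) mulr_sumr; over.
  rewrite -mulr_sumr; congr (_ * _); rewrite [RHS]exchange_big /=.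
  apply: eq_bigr => j _; rewrite -mulrA -pi_aqH_qfall // mulr_sumr.
  by apply: eq_bigr => z _; ring.
apply: (qpoly_sum n n c (fun k y => \sum_(j < k.+1) (qbin q k j * ((-1) ^+ j * q ^+ 'C(j, 2))
                     * (a ^+ j * qp b j / qp (a * b) j)) * ef j y)) => k kn.
apply: (qpoly_sum n k.+1 (fun j => qbin q k j * ((-1) ^+ j * q ^+ 'C(j, 2))
   * (a ^+ j * qp b j / qp (a * b) j)) (fun j y => ef j y)) => j jk.
by apply: qpoly_leq (qpoly_qfall j); lia.
Qed.

(** The degree is exactly [n]: the leading coefficient contains (q^{-n};q)_n and (a b q^{n-1};q)_n,
    both nonzero. *)
Lemma P_lqJ_horner n a b : 0 < a < 1 -> b < 1 ->
  exists2 P : {poly R}, size P = n.+1 & forall x, P_lqJ q n x a b = P.[q ^+ x].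
Proof.
move=> a01 b1; have /andP[a0 a1] := a01; have ab1 := mulr_lt1 a b a01 b1.
pose co k := (- a) ^- n * q ^- 'C(n, 2) * (qp a n / qp b n) *
  (qp (q ^- n) k * qp (a * b * q ^ (n%:Z - 1)) k / (qp a k * qp q k) * q ^+ k).
exists (\poly_(k < n.+1) co k) => [|x]; last first.
  rewrite horner_poly /P_lqJ mulr_sumr; apply: eq_bigr => k _.
  by rewrite /co mulSn exprD exprM; ring.
have qn0 : qp (q ^- n) n != 0.
  rewrite (qpoch_negexp q q01 n n (leqnn n)) subnn qpoch0 divr1.
  apply: mulf_neq0; last exact: qfact_neq0.
  apply: mulf_neq0; last by rewrite expf_neq0 // invr_eq0 expf_neq0.
  by rewrite mulf_neq0 ?signr_eq0 ?expf_neq0.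
(* For n = 0 the parameter a b / q may be 1 or more, but the product is empty; otherwise it is a b
   q^{n-1} < 1. *)
have abn0 : qp (a * b * q ^ (n%:Z - 1)) n != 0.
  case: (n) => [|n']; first by rewrite qpoch0 oner_eq0.
  by rewrite (exprz_natB1 q q01) exprSr mulfK // qpoch_neq0 // mulr_qexp_lt1.
have an0 : qp a n != 0 by rewrite qpoch_neq0.
have bn0 : qp b n != 0 by rewrite qpoch_neq0.
have fn0 : qp q n != 0 by rewrite qfact_neq0.
have Na0 : - a != 0 by rewrite oppr_eq0 gt_eqF.
apply: size_poly_eq; rewrite /co.
repeat (apply: mulf_neq0 => //); rewrite ?invr_eq0 ?mulf_neq0 ?expf_neq0 //.
Qed.

Lemma P_lqJ_at0 n a b : 0 < a < 1 -> b < 1 -> P_lqJ q n 0 a b = 1.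
Proof.
move=> a01 b1; rewrite P_lqJ_qfall // big_ord_recl big1 => [|i _].
  by rewrite /= !qpoch0 expr0 !mulr1 divr1 addr0.
by rewrite qfall_small ?mulr0.
Qed.

(** With falling factorials for the polynomial, the mixed moments give a [qVandermonde_tail] sum
    with t = q^{m+1-n}. Its value (t;q)_n has the zero factor i = n - m - 1. *)
Lemma P_lqJ_orthogonal_exp m n a b : 0 < a < 1 -> b < 1 -> (m < n)%N ->
  sums_to (fun x => pi_lqJ q x a b * P_lqJ q n x a b * (q ^+ m) ^+ x) 0.
Proof.
move=> a01 b1 mn; have /andP[a0 a1] := a01; have ab1 := mulr_lt1 a b a01 b1.
pose be := a * b * q ^ (n%:Z - 1).
pose co k := qp (q ^- n) k * qp be k / (qp b k * qp q k) * (q / a) ^+ k.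
have := sums_to_sum n.+1 _ _ (fun k _ =>
  sums_toZ (co k) _ _ (pi_lqJ_moment q q01 a b m k a01 b1)).
apply: eq_sums_to => [x|].
  rewrite P_lqJ_qfall // mulr_sumr mulr_suml; apply: eq_bigr => k _.
  by rewrite -/be -/(co k); ring.
pose t := q ^+ m.+1 / q ^+ n.
have bt : be * t = a * b * q ^+ m.
  by rewrite /be /t (exprz_natB1 q q01) exprS; have h := qexp_neq0 q q01 n; field; rewrite h.
have tn0 : qp t n = 0.
  have i_n : (n - m.+1 < n)%N by lia.
  apply/eqP/prodf_eq0; exists (Ordinal i_n) => //=.
  rewrite /t mulrAC -exprD subnKC // divff ?subrr //; exact: qexp_neq0.
have key := qVandermonde_tail q q01 n be t.
rewrite tn0 in key.
transitivity (qp a m / qp (a * b) (m + n) * 0); last by rewrite mulr0.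
rewrite -[in RHS]key mulr_sumr.
apply: eq_bigr => -[k /= kn] _.
have E := qpoch_negexp_div q q01 n k kn.
have -> : qbin q n k * ((-1) ^+ k * q ^+ 'C(k, 2)
    * (qp be k * qp (be * t * q ^+ k) (n - k)) * t ^+ k)
  = (qp (q ^- n) k / qp q k) * (q ^+ m.+1) ^+ k
    * (qp be k * qp (be * t * q ^+ k) (n - k)).
  by rewrite E /t exprMn; ring.
have -> : qp (a * b) (m + n)
    = qp (a * b) (k + m) * qp (be * t * q ^+ k) (n - k).
  rewrite bt -mulrA -exprD [(m + k)%N]addnC -qpochD; congr qpoch; lia.
rewrite bt.
have ab1m := mulr_qexp_lt1 q q01 (a * b) m ab1.
have h1 := gt_eqF (qpoch_gt0 q q01 _ k b1).
have h2 := gt_eqF (qpoch_gt0 q q01 _ (k + m) ab1).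
have h3 := gt_eqF (qpoch_gt0 q q01 _ (n - k) (mulr_qexp_lt1 q q01 _ k ab1m)).
have h4 := qfact_neq0 q q01 k.
have h5 : a ^+ k != 0 by rewrite expf_neq0 // gt_eqF.
rewrite /co exprMn exprVn exprS exprMn.
by field; rewrite h1 h2 h3 h4 h5.
Qed.

Lemma orthogonal_qpoly n f a b r :
  (forall m, (m < n)%N ->
     sums_to (fun x => pi_lqJ q x a b * r x * (q ^+ m) ^+ x) 0) ->
  qpoly n f -> sums_to (fun x => pi_lqJ q x a b * r x * f x) 0.
Proof.
move=> h /qpoly_coef[c fE].
have := sums_to_sum n _ _ (fun m mn => sums_toZ (c m) _ _ (h m mn)).
apply: eq_sums_to => [x|]; last by rewrite big1 // => m _; rewrite mulr0.
by rewrite fE mulr_sumr; apply: eq_bigr => m _; ring.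
Qed.

(** Subtracting the multiple of [P_lqJ] with the same coefficient of degree [n] leaves d of lower
    degree, orthogonal to all lower degrees and so to itself. Positivity of [pi_lqJ] forces d = 0;
    evaluation at x = 0 identifies the multiple. *)
Lemma P_lqJ_unique n a b r : 0 < a < 1 -> b < 1 -> qpoly n.+1 r ->
  (forall m, (m < n)%N ->
     sums_to (fun x => pi_lqJ q x a b * r x * (q ^+ m) ^+ x) 0) ->
  forall x, r x = r 0%N * P_lqJ q n x a b.
Proof.
move=> a01 b1 [p pn rp] orth; have /andP[a0 a1] := a01.
have [P sP PE] := P_lqJ_horner n a b a01 b1.
have Pn : P`_n != 0 by have := lead_coef_eq0 P; rewrite lead_coefE sP /= -size_poly_eq0 sP => ->.
pose c := p`_n / P`_n.
have d_poly : qpoly n (fun x => r x - c * P_lqJ q n x a b).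
  exists (p - c *: P) => [|x]; last by rewrite rp PE hornerD hornerN hornerZ.
  apply/leq_sizeP => j; rewrite leq_eqVlt => /predU1P[<-|nj].
    by rewrite coefB coefZ /c (divfK Pn) subrr.
  by rewrite coefB coefZ (leq_sizeP _ _ pn) // (leq_sizeP P n.+1 _) ?sP // mulr0 subr0.
have d_orth m : (m < n)%N -> sums_to (fun x =>
    pi_lqJ q x a b * (r x - c * P_lqJ q n x a b) * (q ^+ m) ^+ x) 0.
  move=> mn.
  have := sums_toD _ _ _ _ (orth m mn)
    (sums_toZ (- c) _ _ (P_lqJ_orthogonal_exp m n a b a01 b1 mn)).
  by apply: eq_sums_to => [x|]; [ring | rewrite mulr0 addr0].
have d0 := orthogonal_qpoly n _ a b _ d_orth d_poly.
have rE x : r x = c * P_lqJ q n x a b.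
  apply/eqP; rewrite -subr_eq0; have := sums_to_eq0 _ _ d0 x.
  have p0 := pi_lqJ_gt0 q q01 x a b a01 b1.
  move=> /(_ _)/eqP; rewrite -mulrA mulf_eq0 gt_eqF //= mulf_eq0 orbb; apply.
  by move=> y; rewrite -mulrA -expr2 mulr_ge0 ?sqr_ge0 // ltW // pi_lqJ_gt0.
by move=> x; rewrite [in LHS]rE rE P_lqJ_at0 // mulr1.
Qed.

End PolynomialsInQx.

(** * Case (iv): a mixture of shifted kernels of type (iii) *)

Section CaseIV.
Context {R : realType} (q : R) (q01 : 0 < q < 1).
Context (a1 b1 a2 b2 : R).
Context (a1_01 : 0 < a1 < 1) (b1_01 : 0 < b1 < 1) (a2_01 : 0 < a2 < 1).
Context (b2_lt1 : b2 < 1).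
Implicit Types (f g r : nat -> R) (j k m n x y z w : nat).

Local Notation qp a n := (qpoch a q n).
Local Notation ef k x := (qpoch (q ^+ x) q^-1 k).
Local Notation K3 := (K_iii q a1 b1 a2).
Local Notation K4 := (K_iv q a1 b1 a2 b2).

Let a2_lt1 : a2 < 1. Proof. by case/andP: a2_01. Qed.
Let b1_lt1 : b1 < 1. Proof. by case/andP: b1_01. Qed.
Let A01 : 0 < a1 * b1 < 1. Proof. exact: mulr_itv01. Qed.
Let B_lt1 : a2 * b2 < 1. Proof. exact: mulr_lt1. Qed.

(** The substitution t = z + t' turns the inner sum of (iv) into the sum defining [K3] at (x - z, y
    - z). *)
Lemma K_iv_sums_to x y z : (z <= minn x y)%N ->
  sums_to (fun t => if (maxn x y <= t)%N then K_iv_term q a1 b1 a2 x y z t else 0)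
          (K3 (x - z) (y - z)).
Proof.
move=> zxy; have [h _] := K_iii_sum1 q q01 (y - z) a1 b1 a2 a1_01 b1_01 a2_lt1.
apply/(sums_to_shift z) => [t tz|]; 
  first by rewrite leqNgt (leq_trans tz) // (leq_trans zxy) // leq_max geq_minl.
apply: eq_sums_to (h (x - z)%N) => // t.
rewrite !geq_max !leq_subLR; case: ifP => // _.
move: zxy; rewrite leq_min => /andP[_ zy].
by rewrite /K_iv_term /K_iii_term addKn subnBA // addnC.
Qed.

Lemma K_iv_cvg x y z : (z <= minn x y)%N ->
  cvgn (fun N => \sum_(maxn x y <= t < N) K_iv_term q a1 b1 a2 x y z t).
Proof.
move=> /K_iv_sums_to; rewrite /sums_to series_from => h.
by apply/cvg_ex; exists (K3 (x - z) (y - z)).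
Qed.

Lemma K_ivE x y :
  K4 x y = \sum_(0 <= z < (minn x y).+1) pi_aqH q z y a2 b2 * K3 (x - z) (y - z).
Proof.
rewrite /K_iv !big_nat; apply: eq_bigr => z; rewrite ltnS /= => zxy.
congr (_ * _); have := K_iv_sums_to x y z zxy.
by rewrite /sums_to series_from => h; apply: cvg_lim h.
Qed.

Lemma K_iv_sums y f (v : nat -> R) :
  (forall z, (z <= y)%N -> sums_to (fun w => K3 w (y - z) * f (z + w)%N) (v z)) ->
  sums_to (fun x => K4 x y * f x) (\sum_(z < y.+1) pi_aqH q z y a2 b2 * v z).
Proof.
move=> /(sums_to_mixture y (fun z => pi_aqH q z y a2 b2) (fun z w => K3 w (y - z))).
by apply: eq_sums_to => // x; rewrite K_ivE.
Qed.

Lemma K_iv_ge0 x y : 0 <= K4 x y.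
Proof.
rewrite K_ivE; apply: sumr_ge0 => z _.
by rewrite mulr_ge0 ?pi_aqH_ge0 ?K_iii_ge0.
Qed.

Lemma K_iv_sum1 y : sums_to (K4 ^~ y) 1.
Proof.
have h z : (z <= y)%N -> sums_to (fun w => K3 w (y - z) * 1) 1.
  by have [] := K_iii_sum1 q q01 (y - z) a1 b1 a2 a1_01 b1_01 a2_lt1.
apply: eq_sums_to (K_iv_sums y (fun=> 1) (fun=> 1) h) => [x|]; first by rewrite mulr1.
by rewrite -mulr_suml mulr1 pi_aqH_sum1.
Qed.

(** Again for each z: [pi_lqJ_split] extracts the common factor [pi_lqJ q z (a1 * b1 * a2) b2], and
    the rest is [K_iii_reversible] at (x - z, y - z). *)
Lemma K_iv_reversible x y :
  K4 x y * pi_lqJ q y (a1 * b1) (a2 * b2) = K4 y x * pi_lqJ q x (a1 * b1) (a2 * b2).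
Proof.
rewrite !K_ivE minnC !mulr_suml !big_nat; apply: eq_bigr => z.
rewrite ltnS leq_min => /and3P[_ zy zx].
rewrite [LHS]mulrAC [RHS]mulrAC ![pi_aqH _ _ _ _ _ * _]mulrC !pi_lqJ_split //.
rewrite -(mulrA (pi_lqJ q z _ b2)) -[in RHS](mulrA (pi_lqJ q z _ b2)).
congr (_ * _); rewrite mulrC [RHS]mulrC.
exact: K_iii_reversible.
Qed.

(** The [pi_aqH] mean keeps the degree at most [k], and the [pi_lqJ] mean is diagonal on powers. *)
Lemma K_iii_exp k : exists d : nat -> R, forall y,
  sums_to (fun x => K3 x y * (q ^+ k) ^+ x) (\sum_(j < k.+1) d j * (q ^+ j) ^+ y).
Proof.
have kpoly : qpoly q k.+1 (fun x => (q ^+ k) ^+ x).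
  by exists 'X^k => [|x]; rewrite ?size_polyXn // hornerXn -!exprM mulnC.
have [c cE] := qpoly_coef _ _ _ (pi_aqH_qpoly q q01 _ b1 a2 _ b1_01 a2_lt1 kpoly).
have [C kC] := qpoly_bounded q q01 _ _ kpoly.
exists (fun j => c j * (qp a1 j / qp (a1 * b1) j)) => y.
apply: (K_iii_expectation q q01 y a1 b1 a2 _ C _ a1_01 b1_01 a2_lt1 kC).
have := sums_to_sum k.+1 _ _ (fun j _ => sums_toZ (c j * (q ^+ j) ^+ y) _ _
  (pi_lqJ_moment q q01 a1 b1 j 0 a1_01 b1_lt1)).
apply: eq_sums_to => [w|].
  rewrite cE mulr_sumr; apply: eq_bigr => j _.
  by rewrite qpoch0 exprD; ring.
by apply: eq_bigr => j _; rewrite !qpoch0 !expr0 add0n; ring.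
Qed.

(** With x = z + w, averaging q^{kw} yields terms q^{j(y-z)} with j <= k. Since q^{kz} q^{j(y-z)} =
    q^{jy} q^{(k-j)z}, averaging over z adds degree at most k - j in q^y, for a total of at most
    k. *)
Lemma K_iv_exp k : exists2 r, qpoly q k.+1 r &
  forall y, sums_to (fun x => K4 x y * (q ^+ k) ^+ x) (r y).
Proof.
have [d dE] := K_iii_exp k.
pose G j y := (q ^+ j) ^+ y * \sum_(z < y.+1) pi_aqH q z y a2 b2 * (q ^+ (k - j)) ^+ z.
exists (fun y => \sum_(j < k.+1) d j * G j y) => [|y].
  apply: qpoly_sum => j; rewrite ltnS => jk.
  rewrite -(subnK (leqW jk)) subSn //.
  apply: qpoly_expM; apply: pi_aqH_qpoly => //.
  by exists 'X^(k - j) => [|x]; rewrite ?size_polyXn // hornerXn -!exprM mulnC.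
pose v z := (q ^+ k) ^+ z * \sum_(j < k.+1) d j * (q ^+ j) ^+ (y - z).
have vE z : (z <= y)%N -> sums_to (fun w => K3 w (y - z) * (q ^+ k) ^+ (z + w)) (v z).
  move=> _; apply: eq_sums_to (sums_toZ ((q ^+ k) ^+ z) _ _ (dE (y - z)%N)) => // w.
  by rewrite exprD mulrCA.
apply: eq_sums_to (K_iv_sums y _ v vE) => //.
under eq_bigr => z _ do rewrite mulrA mulr_sumr.
rewrite exchange_big /=; apply: eq_bigr => -[j /= jk] _.
rewrite /G !mulr_sumr; apply: eq_bigr => -[z /= zy] _.
have -> : (q ^+ k) ^+ z = (q ^+ j) ^+ z * (q ^+ (k - j)) ^+ z.
  by rewrite -exprMn -exprD subnKC.
have -> : (q ^+ j) ^+ y = (q ^+ j) ^+ z * (q ^+ j) ^+ (y - z).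
  by rewrite -exprD subnKC.
ring.
Qed.

Lemma K_iv_qpoly n f : qpoly q n f -> exists2 r, qpoly q n r &
  forall y, sums_to (fun x => K4 x y * f x) (r y).
Proof.
move=> /qpoly_coef[c fE].
have /choice[r hr] k : exists r, qpoly q k.+1 r /\
    forall y, sums_to (fun x => K4 x y * (q ^+ k) ^+ x) (r y).
  by have [r] := K_iv_exp k; exists r.
exists (fun y => \sum_(k < n) c k * r k y) => [|y].
  by apply: qpoly_sum => k kn; apply: qpoly_leq kn (hr k).1.
have := sums_to_sum n _ _ (fun k _ => sums_toZ (c k) _ _ ((hr k).2 y)).
by apply: eq_sums_to => // x; rewrite fE mulr_sumr; apply: eq_bigr => k _; ring.
Qed.

(** At y = 0 only z = 0 occurs, so K4 reduces to K3. On falling factorials the two means contribute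
    b1^k (a2;q)_k / (b1 a2;q)_k and a1^k (b1;q)_k / (a1 b1;q)_k, and the powers of a1 b1 cancel. *)
Lemma K_iv_P_lqJ_at0 n :
  sums_to (fun x => K4 x 0 * P_lqJ q n x (a1 * b1) (a2 * b2))
          (kappa_iv q a1 b1 a2 b2 n).
Proof.
pose P x := P_lqJ q n x (a1 * b1) (a2 * b2).
have [C PC] := P_lqJ_bounded q q01 n (a1 * b1) (a2 * b2).
have h : sums_to (fun x => K3 x 0 * P x) (kappa_iv q a1 b1 a2 b2 n).
  apply: (K_iii_expectation q q01 0 a1 b1 a2 P C _ a1_01 b1_01 a2_lt1 PC).
  pose co k := qp (q ^- n) k * qp (a1 * b1 * (a2 * b2) * q ^ (n%:Z - 1)) k
    / (qp (a2 * b2) k * qp q k) * (q / (a1 * b1)) ^+ k.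
  have := sums_to_sum n.+1 _ _ (fun k _ => sums_toZ
    (co k * (b1 ^+ k * qp a2 k / qp (b1 * a2) k)) _ _
    (pi_lqJ_moment q q01 a1 b1 0 k a1_01 b1_lt1)).
  apply: eq_sums_to => [w|].
    under [in RHS]eq_bigr => x _ do rewrite /P P_lqJ_qfall // mulr_sumr.
    rewrite [in RHS]exchange_big mulr_sumr; apply: eq_bigr => k _.
    under [in RHS]eq_bigr => x _ do rewrite -/(co k) mulrCA.
    rewrite -mulr_sumr pi_aqH_qfall // expr0 expr1n add0n; ring.
  apply: eq_bigr => k _; rewrite /co !expr0 !expr1n qpoch0 addn0 !mulr1.
  rewrite exprMn exprVn exprMn (mulrA (a1 * b1) a2 b2).
  have /andP[a1gt0 _] := a1_01; have /andP[b1gt0 _] := b1_01.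
  have h1 : a1 ^+ k != 0 by rewrite expf_neq0 // gt_eqF.
  have h2 : b1 ^+ k != 0 by rewrite expf_neq0 // gt_eqF.
  have h3 := gt_eqF (qpoch_gt0 q q01 _ k B_lt1).
  have h4 := gt_eqF (qpoch_gt0 q q01 _ k (proj2 (andP A01))).
  have h5 := gt_eqF (qpoch_gt0 q q01 _ k (mulr_lt1 b1 a2 b1_01 a2_lt1)).
  have h6 := qfact_neq0 q q01 k.
  by field; rewrite h1 h2 h3 h4 h5 h6.
have h' z : (z <= 0)%N -> sums_to (fun w => K3 w (0 - z) * P (z + w)%N) (kappa_iv q a1 b1 a2 b2 n).
  by rewrite leqn0 => /eqP->.
apply: eq_sums_to (K_iv_sums 0 P _ h') => //.
by rewrite -mulr_suml pi_aqH_sum1 // mul1r.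
Qed.

(** By [P_lqJ_unique] it suffices that the image [r] of [P] is orthogonal to q^{mx} for m < n.
    Self-adjointness moves the kernel onto q^{mx}, whose image has degree at most m. *)
Lemma K_iv_P_lqJ n y :
  sums_to (fun x => K4 x y * P_lqJ q n x (a1 * b1) (a2 * b2))
          (kappa_iv q a1 b1 a2 b2 n * P_lqJ q n y (a1 * b1) (a2 * b2)).
Proof.
set A := a1 * b1; set B := a2 * b2; pose P x := P_lqJ q n x A B.
have [p sp PE] := P_lqJ_horner q q01 n A B A01 B_lt1.
have Ppoly : qpoly q n.+1 P by exists p; rewrite ?sp.
have [r rpoly rE] := K_iv_qpoly _ _ Ppoly.
suff rP : r y = r 0%N * P y.
  rewrite (sums_to_unique _ _ _ (K_iv_P_lqJ_at0 n) (rE 0%N)) -/A -/B -/(P y) -rP.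
  exact: rE.
apply: (P_lqJ_unique q q01) => // m mn.
have mpoly : qpoly q m.+1 (fun x => (q ^+ m) ^+ x).
  by exists 'X^m => [|x]; rewrite ?size_polyXn // hornerXn -!exprM mulnC.
have [s spoly sE] := K_iv_qpoly _ _ mpoly.
have [C PC] := P_lqJ_bounded q q01 n A B.
pose J y' x := K4 x y' * pi_lqJ q y' A B.
have J0 y' x : 0 <= J y' x by rewrite mulr_ge0 ?K_iv_ge0 // ltW // pi_lqJ_gt0.
have Jr y' : sums_to (J y') (pi_lqJ q y' A B).
  have := sums_toZ (pi_lqJ q y' A B) _ _ (K_iv_sum1 y').
  by apply: eq_sums_to => [x|]; rewrite ?mulr1 // mulrC.
have hb y' x : `|P x * (q ^+ m) ^+ y'| <= C.
  rewrite normrM (le_trans _ (PC x)) // ler_piMr // -exprM ger0_norm ?qexp_le1 //.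
  by rewrite ltW // qexp_gt0.
(* Both orders of summation of one double series: x first gives the pairing of [r] with q^{my}, and
   y' first, after reversibility, gives that of [P] with [s]. *)
have [v [w [T [hv hw vT wT]]]] := fubini J (fun y' x => P x * (q ^+ m) ^+ y') C _ 1 J0 Jr
  (pi_lqJ_sum1 q q01 A B A01 B_lt1) hb.
have vE y' : v y' = pi_lqJ q y' A B * r y' * (q ^+ m) ^+ y'.
  apply: sums_to_unique (hv y') _.
  have := sums_toZ (pi_lqJ q y' A B * (q ^+ m) ^+ y') _ _ (rE y').
  by apply: eq_sums_to => [x|]; rewrite /J; ring.
have wE x : w x = pi_lqJ q x A B * P x * s x.
  apply: sums_to_unique (hw x) _.
  have := sums_toZ (pi_lqJ q x A B * P x) _ _ (sE x).
  by apply: eq_sums_to => // y'; rewrite /J K_iv_reversible -/A -/B; ring.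
apply: eq_sums_to vT => [y'|]; first by rewrite vE.
apply: sums_to_unique wT _.
have := orthogonal_qpoly q n s A B P
  (fun k kn => P_lqJ_orthogonal_exp q q01 k n A B A01 B_lt1 kn) (qpoly_leq q _ _ _ mn spoly).
by apply: eq_sums_to => // x; rewrite wE.
Qed.

Lemma K_iv_solvable :
  (forall x y z, (z <= minn x y)%N ->
     cvgn (fun N => \sum_(maxn x y <= t < N) K_iv_term q a1 b1 a2 x y z t))
  /\ lqJ_solvable q (a1 * b1) (a2 * b2) K4 (kappa_iv q a1 b1 a2 b2).
Proof.
split; first exact: K_iv_cvg.
apply: (lqJ_solvableI q) => //.
- exact: K_iv_ge0.
- exact: K_iv_sum1.
- exact: K_iv_reversible.
- exact: K_iv_P_lqJ.
Qed.

End CaseIV.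

Theorem mainTheorem12 (R : realType) (q : R) (hq : 0 < q < 1) :
  [/\ (* (i) *)
      forall a b c : R, 0 < a < 1 -> b < 1 -> 0 < c < 1 ->
        lqJ_solvable q c (a * b) (K_i q a b c) (kappa_i q a b c),
      (* (iii) *)
      forall a b c : R, 0 < a < 1 -> 0 < b < 1 -> c < 1 ->
        (forall x y : nat,
           cvgn (fun N : nat =>
             \sum_(maxn x y <= z < N) K_iii_term q a b c x y z))
        /\ lqJ_solvable q (a * b) c (K_iii q a b c) (kappa_iii q a b c)
    & (* (iv) *)
      forall a1 b1 a2 b2 : R,
        0 < a1 < 1 -> 0 < b1 < 1 -> 0 < a2 < 1 -> b2 < 1 ->
        (forall x y z2 : nat, (z2 <= minn x y)%N ->
           cvgn (fun N : nat =>
             \sum_(maxn x y <= z1 < N) K_iv_term q a1 b1 a2 x y z2 z1))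
        /\ lqJ_solvable q (a1 * b1) (a2 * b2)
             (K_iv q a1 b1 a2 b2) (kappa_iv q a1 b1 a2 b2)].
Proof.
split.
- exact: K_i_solvable.
- exact: K_iii_solvable.
- move=> a1 b1 a2 b2; exact: K_iv_solvable.
Qed.
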